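(* Let $\lambda,\delta>0$, let $l\ge1$ be an integer, and denote $\exp_2(x)=2^x$. Let $$c_i=\lfloor\underbrace{\exp_2\ldots\exp_2}_{l\text{ times}}(\lambda i)\rfloor,\qquad i\ge1,$$ where $\lambda$ and $l$ are such that the sequence $\mathfrak{c}=\{c_i\}$ is strictly increasing, and let $F:\mathbb{C}^2\to\mathbb{C}^2$ be the Cornalba--Shiffman map corresponding to $\mathfrak{c}$. Then there exists a constant $m_{l,\lambda,\delta}$ (depending only on $l,\lambda,\delta$) such that for all $r\ge\underbrace{\exp_2\ldots\exp_2}_{l+1\text{ times}}(1)$ it holds $$\zeta^0(F,r,\delta)\le\frac1\lambda\underbrace{\log\ldots\log}_{l+1\text{ times}}r+m_{l,\lambda,\delta}.$$ In particular, for $c_i=2^{2^i}$ we have $\zeta^0(F,r,\delta)=O(\log\log\log r)$ as $r\to\infty$.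
   Context: $\log$ denotes the logarithm to base $2$; $\underbrace{\log\ldots\log}_{k\text{ times}}$ and $\underbrace{\exp_2\ldots\exp_2}_{k\text{ times}}$ denote $k$-fold compositions. $|\cdot|$ is the Euclidean norm and $B_r$ is the closed ball of radius $r$ centered at $0$. An island is a connected component of $\{|F|\le\delta\}\cap B_r$ which is disjoint from $\partial B_r$, and $\zeta^0(F,r,\delta)$ denotes the number of islands. Cornalba--Shiffman map: let $g(z)=\prod_{i=1}^\infty\left(1-\frac{z}{2^i}\right)$ for $z\in\mathbb{C}$; for an integer $k\ge1$ let $g_k(z)=\prod_{i\ge1,\,i\ne k}\left(1-\frac{z}{2^i}\right)$; for a positive integer $c$ let $P_c(w)=\prod_{j=1}^c\left(w-\frac1j\right)$. Given a strictly increasing sequence of positive integers $\mathfrak{c}=\{c_i\}_{i\ge 1}$, set $f(z,w)=\sum_{i=1}^\infty 2^{-c_i^2}g_i(z)P_{c_i}(w)$ and $F(z,w)=(g(z),f(z,w))$. All products and sums converge uniformly on compact sets, so $F:\mathbb{C}^2\to\mathbb{C}^2$ is holomorphic. *)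

(* Defs.v *)
From HB Require Import structures.
From mathcomp Require Import all_boot all_order all_algebra.
From mathcomp Require Import all_classical all_reals all_analysis.
From mathcomp Require Import complex.

Set Implicit Arguments.
Unset Strict Implicit.
Unset Printing Implicit Defensive.

Import Order.TTheory GRing.Theory Num.Theory.
Import numFieldNormedType.Exports.

Local Open Scope classical_set_scope.
Local Open Scope ring_scope.

(* The regular alias carries the topology induced by the modulus. *)
Notation Cplx R := (R[i]^o)%type.

Section Islands.
Variable R : realType.

Definition euclid_norm (p : Cplx R * Cplx R) : R :=
  Num.sqrt (ComplexField.Normc.normc p.1 ^+ 2
            + ComplexField.Normc.normc p.2 ^+ 2).

Definition cball (r : R) : set (Cplx R * Cplx R) := [set p | euclid_norm p <= r].

Definition boundary (T : topologicalType) (A : set T) : set T :=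
  closure A `\` A°.

Definition sublevel (F : Cplx R * Cplx R -> Cplx R * Cplx R) (r delta : R) :
    set (Cplx R * Cplx R) :=
  [set p | euclid_norm (F p) <= delta] `&` cball r.

Definition islands (F : Cplx R * Cplx R -> Cplx R * Cplx R) (r delta : R) :
    set (set (Cplx R * Cplx R)) :=
  [set I | (exists2 p, sublevel F r delta p &
              I = connected_component (sublevel F r delta) p) /\
           I `&` boundary (cball r) = set0].

(* Valued in the extended reals: it is +oo when there are infinitely many
   islands, so an upper bound on it asserts finiteness. *)
Definition zeta0 (F : Cplx R * Cplx R -> Cplx R * Cplx R) (r delta : R) : \bar R :=
  counting (islands F r delta).

End Islands.

Section CornalbaShiffman.
Variable R : realType.

Definition cs_g (z : Cplx R) : Cplx R :=
  limn (fun n : nat => \prod_(1 <= i < n.+1) (1 - z / 2 ^+ i) : Cplx R).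

Definition cs_gk (k : nat) (z : Cplx R) : Cplx R :=
  limn (fun n : nat =>
    \prod_(1 <= i < n.+1 | i != k) (1 - z / 2 ^+ i) : Cplx R).

Definition cs_P (c : nat) (w : Cplx R) : Cplx R :=
  \prod_(1 <= j < c.+1) (w - j%:R^-1).

Definition strictly_increasing_from1 (c : nat -> nat) : Prop :=
  forall i j, (1 <= i)%N -> (i < j)%N -> (c i < c j)%N.

(* Only the values [c i] with [1 <= i] are used. *)
Definition cs_f (c : nat -> nat) (z w : Cplx R) : Cplx R :=
  limn (fun n : nat =>
    \sum_(1 <= i < n.+1) 2 ^- (c i ^ 2) * cs_gk i z * cs_P (c i) w : Cplx R).

Definition cs_map (c : nat -> nat) (p : Cplx R * Cplx R) : Cplx R * Cplx R :=
  (cs_g p.1, cs_f c p.1 p.2).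

End CornalbaShiffman.

Section IteratedExpLog.
Variable R : realType.

Definition exp2 (x : R) : R := 2 `^ x.

(* Meaningful only for [0 < x]: [ln] is total, with value 0 elsewhere. *)
Definition log2 (x : R) : R := ln x / ln 2.

(* [Num.truncn] is the floor here, its argument being positive. *)
Definition exp_seq (l : nat) (lambda : R) (i : nat) : nat :=
  Num.truncn (iter l exp2 (lambda * i%:R)).

(* The filter [+oo], bundled as the Landau notations require. *)
Definition at_pinfty : filter_on R :=
  FilterType (pinfty_nbhs R) _.

End IteratedExpLog.

(* Main.v *)
Require Import Defs.
From mathcomp Require Import all_boot all_order all_algebra.
From mathcomp Require Import all_classical all_reals all_analysis.
From mathcomp Require Import complex.
From mathcomp Require Import finmap ring lra zify.

Set Implicit Arguments.
Unset Strict Implicit.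
Unset Printing Implicit Defensive.

Import Order.TTheory GRing.Theory Num.Theory.
Import numFieldNormedType.Exports.

Local Open Scope classical_set_scope.
Local Open Scope ring_scope.

(** Over [z = 2 ^ k] every term of [f] but the [k]-th vanishes, so that
    [F (2 ^ k, w) = (0, 2 ^- (c k ^ 2) * g_k (2 ^ k) * P_(c k) w)]; the zeros of
    [F] are the points [(2 ^ k, 1 / j)] with [1 <= j <= c k].  Two facts turn
    this list into a bound on the number of islands.

    Every island contains a zero ([island_at_zero]).  An island is a component
    of a compact set, disjoint from the sphere; if it contained none of the
    finitely many zeros in the ball, it would have an open neighbourhood [U]
    inside the ball, also free of zeros, with [|F| > delta] on its boundary.
    Truncating the products and the series gives maps
    [Phi (z, w) = (G z, H z w)], polynomial in each fibre, which approximate [F]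
    uniformly on the ball and whose zeros are among those of [F].  Such a map
    has a zero in [U] as soon as [|Phi|] is smaller at some point of [U] than on
    its boundary ([skew_polynomial_zero]): at a minimum of [|Phi|] the minimum
    modulus principle in the fibre gives [H z w = 0]; this root moves
    continuously with [z], and the minimum modulus principle for [G] then gives
    [G z = 0].  Only the minimum modulus principle for polynomials in one
    variable is used, so no theory of holomorphic functions enters.

    The zeros over one [k] cluster ([cs_map_slice_small]).  Since
    [|g_k (2 ^ k)| <= 2 ^ (k (k - 1) / 2)] and [k <= c k], one has
    [|F (2 ^ k, w)| ^ 2 <= 2 ^- (c k)] whenever [(1 + |w|) ^ 2 <= 2 ^ (c k)].
    Hence for [k] large the segment from [(2 ^ k, 0)] to any zero over [k] lies
    in the sublevel set, and all these zeros belong to one component.  If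
    moreover [4 r ^ 2 <= 2 ^ (c k)], the segment can be prolonged up to the
    sphere, and the component is not an island.  The number of islands is
    therefore at most a constant plus the number of [k] with
    [2 ^ (c k) < 4 r ^ 2] ([cs_islands_bound]).  For iterated exponentials this
    inequality reads, up to rounding, [exp_2^l (lambda k) < 2 log r + 2], and
    iterating the logarithm [l] times reduces the factor and the constant to an
    additive error ([iter_exp2_log2_add2]). *)

Notation normc := ComplexField.Normc.normc.

(** * Clopen neighbourhoods of components in compact sets *)

Lemma compact_normal_open (T : topologicalType) (K A B : set T) :
  hausdorff_space T -> compact K -> A `<=` K° -> closed A -> closed B ->
  A `&` B = set0 ->
  exists U, [/\ open U, A `<=` U & closure U `&` B = set0].
Proof.
move=> hT cK AK clA clB AB0.
have nbB : set_nbhs A (~` B).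
  apply/set_nbhsP; exists (~` B); split=> //; first exact: closed_openC.
  by apply/disjoints_subset.
have [U /set_nbhsP[C [oC AC CU]] UB] := compact_normal_local hT cK AK clA nbB.
exists C; split=> //; apply/disjoints_subset.
by apply: subset_trans UB; apply: closureS.
Qed.

(** A cluster point of the filter generated by the traces [V `&` Z] lies in
    every [V] and in [Z]. *)
Lemma compact_directed_closed (T : topologicalType) (X Z : set T)
    (D : set (set T)) :
  compact X -> closed Z -> D !=set0 ->
  (forall V, D V -> closed V /\ V `<=` X) ->
  (forall V W, D V -> D W -> D (V `&` W)) ->
  (forall V, D V -> V `&` Z !=set0) ->
  (\bigcap_(V in D) V) `&` Z !=set0.
Proof.
move=> cX clZ [V0 DV0] Dcl DI DZ.
pose F := filter_from D (fun V => V `&` Z).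
have FF : ProperFilter F.
  apply: filter_from_proper; last by move=> V /DZ.
  apply: filter_from_filter; first by exists V0.
  move=> V W DV DW; exists (V `&` W); first exact: DI.
  by move=> x [[Vx Wx] Zx].
have FX : F X by exists V0 => // x [/(proj2 (Dcl _ DV0))].
have [x [Xx clx]] := cX F FF FX.
exists x; split.
- move=> V DV; apply: (proj1 (Dcl _ DV)) => N Nx.
  have FV : F V by exists V => // y [].
  exact: clx.
- apply: clZ => N Nx.
  have FZ : F Z by exists V0 => // y [].
  exact: clx.
Qed.

Definition clopen_part (T : topologicalType) (X V : set T) :=
  [/\ closed V, V `<=` X & closed (X `\` V)].

(** In a compact set the intersection [Q] of the clopen parts containing [p]
    is connected: if [Q] splits into two closed pieces, these are separated by
    an open set whose boundary some clopen part avoids, and cutting that part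
    along the open set removes one piece from [Q].  Hence [Q] lies in the
    component of [p], and compactness finds one clopen part avoiding [Z]. *)
Lemma clopen_part_avoiding (T : topologicalType) (K X Z : set T) (p : T) :
  hausdorff_space T -> compact K -> X `<=` K° -> closed X -> closed Z ->
  X p -> connected_component X p `&` Z = set0 ->
  exists V, [/\ clopen_part X V, V p & V `&` Z = set0].
Proof.
move=> hT cK XK clX clZ Xp XpZ.
have cX : compact X.
  by apply: subclosed_compact cK _ => //; apply: subset_trans XK (@interior_subset _ _).
pose D : set (set T) := [set V | clopen_part X V /\ V p].
have DX : D X.
  by split=> //; split=> //; rewrite setDv; exact: closed0.
have Dcl V : D V -> closed V /\ V `<=` X by move=> [[]].
have DI V W : D V -> D W -> D (V `&` W).
  move=> [[cV VX cXV] Vp] [[cW WX cXW] Wp]; split=> //; split.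
  - exact: closedI.
  - by move=> x [/VX].
  - by rewrite setDIr; exact: closedU.
have avoid Y : closed Y -> (\bigcap_(V in D) V) `&` Y = set0 ->
    exists2 V, D V & V `&` Y = set0.
  move=> clY QY; apply: contrapT => nV.
  have : (\bigcap_(V in D) V) `&` Y !=set0.
    apply: (compact_directed_closed cX clY) => //; first by exists X.
    move=> V DV; apply/set0P/eqP => VY; apply: nV; by exists V.
  by rewrite QY => -[].
pose Q := \bigcap_(V in D) V.
have Qp : Q p by move=> V [].
have QX : Q `<=` X by move=> x /(_ _ DX).
have clQ : closed Q by apply: closed_bigI => V /Dcl[].
(* It suffices to treat the case where [p] lies in the first piece. *)
have key A1 A2 : closed A1 -> closed A2 -> A1 p -> Q = A1 `|` A2 ->
    A1 `&` A2 = set0 -> A2 = set0.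
  move=> cl1 cl2 A1p QE A12.
  have A1K : A1 `<=` K°.
    by apply: subset_trans XK; apply: subset_trans QX; rewrite QE; exact: subsetUl.
  have [U [oU A1U UA2]] := compact_normal_open hT cK A1K cl1 cl2 A12.
  have [V [[cV VX cXV] Vp] VZ] : exists2 V, D V & V `&` (closure U `\` U) = set0.
    apply: avoid; first by apply: closedI; [exact: closed_closure|exact: open_closedC].
    rewrite -/Q QE; apply/seteqP; split=> // x [[/A1U Ux [_ //]|A2x [Ux _]]].
    by have : (closure U `&` A2) x by []; rewrite UA2.
  have VU : V `&` U = V `&` closure U.
    apply/seteqP; split=> x [Vx Ux]; split=> //; first exact: subset_closure.
    apply: contrapT => nUx.
    by have : (V `&` (closure U `\` U)) x by []; rewrite VZ.
  have DVU : D (V `&` U).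
    split; last by split=> //; apply: A1U.
    split; first by rewrite VU; apply: closedI => //; exact: closed_closure.
      by move=> x [/VX].
    rewrite setDIr; apply: closedU => //.
    by apply: closedI => //; exact: open_closedC.
  apply/seteqP; split=> // x A2x.
  have Qx : Q x by rewrite QE; right.
  have [_ Ux] := Qx _ DVU.
  by rewrite -UA2; split; [exact: subset_closure|].
have cQ : connected Q.
  move=> B [b Bb] [C oC BE] [C' clC' BE'].
  have clB : closed B by rewrite BE'; exact: closedI.
  have BQ : B `<=` Q by rewrite BE; move=> x [].
  have clQB : closed (Q `\` B).
    rewrite (_ : Q `\` B = Q `&` ~` C); first by apply: closedI => //; exact: open_closedC.
    rewrite BE; apply/seteqP; split=> x [Qx nx]; split=> //.
      by move=> Cx; apply: nx.
    by move=> [].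
  have QBE : Q = B `|` (Q `\` B) by rewrite setDUK.
  have [Bp|nBp] := pselect (B p).
    have BQB : B `&` (Q `\` B) = set0 by apply/seteqP; split=> // x [? []].
    move: (key B (Q `\` B) clB clQB Bp QBE BQB); rewrite setD_eq0 => QB.
    by apply/seteqP.
  have QBE' : Q = (Q `\` B) `|` B by rewrite setUC -QBE.
  have QBB : (Q `\` B) `&` B = set0 by apply/seteqP; split=> // x [[]].
  by move: Bb; rewrite (key (Q `\` B) B clQB clB (conj Qp nBp) QBE' QBB).
have [V DV VZ] : exists2 V, D V & V `&` Z = set0.
  apply: avoid => //; apply/seteqP; split=> // x [Qx Zx].
  suff : (connected_component X p `&` Z) x by rewrite XpZ.
  split=> //; exact: (connected_component_max Qp QX cQ).
by exists V; case: DV.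
Qed.

(** * The topology of the complex plane *)

Section ComplexPlane.
Variable R : realType.
Implicit Types (z w : Cplx R) (x e : R).

Lemma normcE_norm z : `|z| = (normc z)%:C%C.
Proof. by case: z. Qed.

Lemma normc_ge0 z : 0 <= normc z.
Proof. by case: z => a b /=; exact: sqrtr_ge0. Qed.

Lemma normc_real x : normc (x%:C%C : Cplx R) = `|x|.
Proof. by rewrite /= expr0n addr0 sqrtr_sqr. Qed.

Lemma normc_nat (n : nat) : normc (n%:R : Cplx R) = n%:R.
Proof.
by rewrite -[n%:R](rmorph_nat (real_complex R)) normc_real ger0_norm.
Qed.

Lemma normcX z n : normc (z ^+ n) = normc z ^+ n.
Proof.
elim: n => [|n IH]; first by rewrite !expr0 ComplexField.Normc.normc1.
by rewrite !exprS ComplexField.Normc.normcM IH.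
Qed.

Lemma normcB z w : normc (z - w) = normc (w - z).
Proof. by rewrite -normcN opprB. Qed.

Lemma ler_normc_sub z w : normc z - normc w <= normc (z - w).
Proof. by rewrite lerBlDr (le_trans _ (le_normcD _ _)) // subrK. Qed.

Lemma ler_normc_dist z w : `|normc z - normc w| <= normc (z - w).
Proof.
rewrite ler_norml ler_normc_sub andbT lerNl opprB (normcB z).
exact: ler_normc_sub.
Qed.

Lemma normc_Re z : `|complex.Re z| <= normc z.
Proof.
case: z => a b /=; rewrite -sqrtr_sqr; apply: ler_wsqrtr.
by rewrite lerDl sqr_ge0.
Qed.

Lemma normc_Im z : `|complex.Im z| <= normc z.
Proof.
case: z => a b /=; rewrite -sqrtr_sqr; apply: ler_wsqrtr.
by rewrite lerDr sqr_ge0.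
Qed.

Lemma normc_le_ReIm z : normc z <= `|complex.Re z| + `|complex.Im z|.
Proof.
case: z => a b /=; rewrite -[leRHS]ger0_norm ?addr_ge0 // -sqrtr_sqr.
apply: ler_wsqrtr; rewrite sqrrD !real_normK ?num_real // lerD2r lerDl.
by rewrite mulrn_wge0 // mulr_ge0.
Qed.

(** The topology of [Cplx R] is generated by balls with radii in [R[i]]; these
    two lemmas restate neighbourhoods with real radii and the real modulus. *)
Lemma nbhs_CplxP z (A : set (Cplx R)) :
  nbhs z A <-> exists2 e : R, 0 < e & forall w, normc (w - z) < e -> A w.
Proof.
split=> [/nbhs_ballP[[a b] /=]|[e e0 eA]].
  rewrite ltcE /= => /andP[/eqP -> a0 aA]; exists a => // w wz; apply: aA.
  by rewrite /ball /= normcE_norm normcB (ltcR (normc (w - z)) a).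
apply/nbhs_ballP; exists (e%:C%C) => /=; first by rewrite (ltcR 0 e).
by move=> w; rewrite /ball /= normcE_norm normcB (ltcR _ e); exact: eA.
Qed.

Lemma nbhs_Cplx2P (p : Cplx R * Cplx R) (A : set (Cplx R * Cplx R)) :
  nbhs p A <-> exists2 e : R, 0 < e &
    forall q, normc (q.1 - p.1) < e -> normc (q.2 - p.2) < e -> A q.
Proof.
split=> [[[B1 B2] [/= /nbhs_CplxP[e1 e10 eB1] /nbhs_CplxP[e2 e20 eB2]] BA]|].
  exists (Order.min e1 e2); first by rewrite lt_min e10.
  move=> q; rewrite !lt_min => /andP[q1 _] /andP[_ q2]; apply: BA.
  by split; [exact: eB1|exact: eB2].
move=> [e e0 eA]; exists ([set w | normc (w - p.1) < e], [set w | normc (w - p.2) < e]).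
  by split; apply/nbhs_CplxP; exists e.
by move=> q [/= q1 q2]; exact: eA.
Qed.

Lemma continuous_normc : continuous (fun z : Cplx R => normc z : R^o).
Proof.
move=> z A /nbhs_ballP[e /= e0 eA]; apply/nbhs_CplxP; exists e => // w wz.
by apply/eA/(le_lt_trans _ wz); rewrite normcB; exact: ler_normc_dist.
Qed.

Lemma continuous_CplxD (T : topologicalType) (f g : T -> Cplx R) :
  continuous f -> continuous g -> continuous (fun t => f t + g t : Cplx R).
Proof.
move=> cf cg t; exact: (@continuousD R[i] (Cplx R) T f g t (cf t) (cg t)).
Qed.

Lemma continuous_CplxM (T : topologicalType) (f g : T -> Cplx R) :
  continuous f -> continuous g -> continuous (fun t => f t * g t : Cplx R).
Proof.
move=> cf cg t; exact: (@continuousM R[i] T f g t (cf t) (cg t)).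
Qed.

Lemma Cplx_hausdorff : hausdorff_space (Cplx R).
Proof. exact: norm_hausdorff. Qed.

Lemma Cplx2_hausdorff : hausdorff_space (Cplx R * Cplx R)%type.
Proof. exact: norm_hausdorff. Qed.

Lemma continuous_Complex : continuous (fun t : R^o * R^o => (t.1 +i* t.2)%C : Cplx R).
Proof.
move=> t A /nbhs_CplxP[e e0 eA].
have e20 : 0 < e / 2 by rewrite divr_gt0.
exists (ball t.1 (e / 2), ball t.2 (e / 2)); first by split; exact: nbhsx_ballx.
move=> s [/= s1 s2]; apply: eA; apply: le_lt_trans (normc_le_ReIm _) _ => /=.
rewrite (splitr e) ltrD //; rewrite distrC.
  exact: s1.
exact: s2.
Qed.

Lemma compact_normc_ball (r : R) : compact [set z : Cplx R | normc z <= r].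
Proof.
apply: (@subclosed_compact _ _
  ((fun t : R^o * R^o => (t.1 +i* t.2)%C : Cplx R) @` (`[- r, r] `*` `[- r, r]))).
- apply: (@closed_comp _ _ (fun z : Cplx R => normc z : R^o) [set x | x <= r]).
    by move=> z _; exact: continuous_normc.
  exact: closed_le.
- apply: continuous_compact.
    by apply: continuous_subspaceT; exact: continuous_Complex.
  by apply: compact_setX; exact: segment_compact.
- move=> z /= zr; exists (complex.Re z, complex.Im z); last by case: (z).
  split=> /=; rewrite in_itv /= -ler_norml.
    exact: le_trans (normc_Re _) zr.
  exact: le_trans (normc_Im _) zr.
Qed.

End ComplexPlane.

Section Convergence.
Variable R : realType.
Implicit Types (z w : Cplx R) (x e : R).

Lemma exists_expn2_gt x : exists N : nat, x < 2 ^+ N.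
Proof.
exists (Num.truncn `|x|).+1.
rewrite (le_lt_trans (ler_norm x)) // (lt_le_trans (truncnS_gt _)) //.
by rewrite -natrX ler_nat ltnW // ltn_expl.
Qed.

Lemma exists_geometric_lt x e : 0 < e -> exists N : nat, x / 2 ^+ N < e.
Proof.
move=> e0; have [N xN] := exists_expn2_gt (x / e).
by exists N; rewrite ltr_pdivrMr ?exprn_gt0 // mulrC -ltr_pdivrMr.
Qed.

Lemma geometric_cvg (u : nat -> Cplx R) (l : Cplx R) (K : R) :
  (forall n, normc (l - u n) <= K / 2 ^+ n) -> u @ \oo --> l.
Proof.
move=> uK A /nbhs_CplxP[e e0 eA].
have K0 : 0 <= K by have := uK 0%N; rewrite expr0 divr1; apply: le_trans; exact: normc_ge0.
have [N KN] := exists_geometric_lt K e0.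
exists N => // n /= Nn; apply: eA; rewrite normcB.
apply: le_lt_trans (uK n) _; apply: le_lt_trans KN.
rewrite ler_wpM2l // lef_pV2 ?posrE ?exprn_gt0 //.
by rewrite ler_eXn2l // ltr1n.
Qed.

(** Subtracting the second geometric term makes the telescoping exact, so the
    induction closes. *)
Lemma geometric_increments (u : nat -> Cplx R) (B : R) :
  (forall n, normc (u n.+1 - u n) <= B / 2 ^+ n) ->
  forall n k, normc (u (n + k)%N - u n) <= 2 * B / 2 ^+ n - 2 * B / 2 ^+ (n + k).
Proof.
move=> uB n; elim=> [|k IH].
  by rewrite addn0 !subrr ComplexField.Normc.normc0.
rewrite -(subrK (u (n + k)%N) (u (n + k.+1)%N)) -addrA.
apply: le_trans (le_normcD _ _) _.
have /le_trans := lerD (uB (n + k)%N) IH; rewrite -addnS; apply.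
rewrite addnS exprS invfM.
set a := B / _; set b := _ / _ ^+ n.
have -> : 2 * B * (2^-1 * (2 ^+ (n + k))^-1) = a by rewrite /a mulrACA divff ?mul1r // pnatr_eq0.
have -> : 2 * B / 2 ^+ (n + k) = a + a by rewrite /a -mulrA mulr_natl mulr2n.
lra.
Qed.

(** The limit is the supremum of the lower bounds [v n - K / 2 ^+ n]; each
    [v m + K / 2 ^+ m] bounds them from above. *)
Lemma geometric_real_limit (v : nat -> R) (K : R) :
  (forall n m, `|v m - v n| <= K / 2 ^+ n + K / 2 ^+ m) ->
  exists s, forall n, `|s - v n| <= K / 2 ^+ n.
Proof.
move=> vK; pose S : set R := range (fun n => v n - K / 2 ^+ n).
have ubS n : ubound S (v n + K / 2 ^+ n).
  move=> _ [m _ <-]; rewrite lerBlDr -addrA -lerBlDl.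
  by rewrite (le_trans (ler_norm _)) // (le_trans (vK n m)).
have S0 : S !=set0 by exists (v 0%N - K / 2 ^+ 0), 0%N.
exists (sup S) => n; rewrite ler_distl; apply/andP; split.
  by apply: ub_le_sup; [exists (v 0%N + K / 2 ^+ 0); exact: ubS|exists n].
by apply: ge_sup => // x Sx; exact: ubS.
Qed.

(** This stands for the completeness of the complex plane, obtained from that
    of [R] on real and imaginary parts; it also yields a rate of convergence. *)
Lemma geometric_limit (u : nat -> Cplx R) (B : R) :
  (forall n, normc (u n.+1 - u n) <= B / 2 ^+ n) ->
  exists l : Cplx R, forall n, normc (l - u n) <= 4 * B / 2 ^+ n.
Proof.
move=> uB.
have B0 : 0 <= B by have := uB 0%N; rewrite expr0 divr1; apply: le_trans; exact: normc_ge0.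
have pos n : 0 <= 2 * B / 2 ^+ n by rewrite divr_ge0 ?mulr_ge0 ?exprn_ge0.
have inc n k : normc (u (n + k)%N - u n) <= 2 * B / 2 ^+ n.
  by apply: le_trans (geometric_increments uB n k) _; rewrite gerBl pos.
have dist n m : normc (u m - u n) <= 2 * B / 2 ^+ n + 2 * B / 2 ^+ m.
  have [nm|/ltnW mn] := leqP n m.
    by rewrite -(subnKC nm); apply: le_trans (inc _ _) _; rewrite lerDl pos.
  by rewrite normcB -(subnKC mn); apply: le_trans (inc _ _) _; rewrite lerDr pos.
have ReB z w : complex.Re (z - w) = complex.Re z - complex.Re w by case: z; case: w.
have ImB z w : complex.Im (z - w) = complex.Im z - complex.Im w by case: z; case: w.
have [|a aP] := @geometric_real_limit (fun n => complex.Re (u n)) (2 * B).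
  by move=> n m; rewrite -ReB (le_trans (normc_Re _)).
have [|b bP] := @geometric_real_limit (fun n => complex.Im (u n)) (2 * B).
  by move=> n m; rewrite -ImB (le_trans (normc_Im _)).
exists (a +i* b)%C => n; apply: le_trans (normc_le_ReIm _) _.
rewrite ReB ImB /=.
apply: le_trans (lerD (aP n) (bP n)) _.
by rewrite -mulrDl -mulrDl -natrD.
Qed.

End Convergence.

Section MinimumModulus.
Variable R : realType.
Implicit Types (p : {poly R[i]}) (w : Cplx R) (e : R).

Lemma continuous_poly p : continuous (fun w : Cplx R => p.[w] : Cplx R).
Proof.
elim/poly_ind: p => [|p c IH] w.
  rewrite (_ : (fun _ : Cplx R => _) = fun=> 0); last by apply/funext => z; rewrite horner0.
  by apply: (@cst_continuous (Cplx R) (Cplx R) 0).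
rewrite (_ : (fun _ : Cplx R => _) = fun z : Cplx R => (p.[z] * z + c) : Cplx R); last first.
  by apply/funext => z; rewrite hornerMXaddC.
apply: continuous_CplxD; last exact: (@cst_continuous (Cplx R) (Cplx R)).
by apply: continuous_CplxM; [exact: IH|move=> y A].
Qed.

Lemma poly_eps_delta p w e : 0 < e ->
  exists2 d : R, 0 < d &
    forall z : Cplx R, normc (z - w) < d -> normc (p.[z] - p.[w]) < e.
Proof.
move=> e0; apply/(nbhs_CplxP w [set z | normc (p.[z] - p.[w]) < e]).
apply: (@continuous_poly p w [set y : Cplx R | normc (y - p.[w]) < e]).
by apply/nbhs_CplxP; exists e.
Qed.

(** The minimum modulus principle, by the argument of d'Alembert: write
    [p = a + s * ('X - w) ^ k] with [s.[w] != 0] and move from [w] in a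
    direction [zeta] such that [s.[w] * zeta ^ k = - a]. *)
Lemma poly_smaller_modulus p w e : (1 < size p)%N -> p.[w] != 0 -> 0 < e ->
  exists2 w' : Cplx R, normc (w' - w) < e & normc p.[w'] < normc p.[w].
Proof.
move=> sp pw e0; set a := p.[w] in pw *.
have q0 : p - a%:P != 0.
  rewrite subr_eq0; apply/eqP => pa; move: sp; rewrite pa size_polyC.
  by case: (a != 0).
have [k [s]] := multiplicity_XsubC (p - a%:P) w.
rewrite q0 /= => sw qE.
have k0 : (0 < k)%N.
  rewrite lt0n; apply/eqP => k0; move: sw.
  by rewrite k0 expr0 mulr1 in qE; rewrite -qE /root !hornerE subrr eqxx.
have pE x : p.[x] = a + s.[x] * (x - w) ^+ k.
  have := congr1 (horner^~ x) qE; rewrite /= !hornerE => <-.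
  by rewrite addrC subrK.
pose zeta : R[i] := k.-root (- a / s.[w]).
have zk : zeta ^+ k = - a / s.[w] by rewrite rootCK.
have Na : 0 < normc a.
  rewrite lt_neqAle normc_ge0 andbT eq_sym; apply: contra pw => /eqP.
  by move/ComplexField.Normc.eq0_normc => ->.
have zk0 : 0 < normc (zeta ^+ k).
  rewrite lt_neqAle normc_ge0 andbT eq_sym; apply/eqP.
  move/ComplexField.Normc.eq0_normc/eqP; rewrite zk mulf_eq0 invr_eq0 oppr_eq0.
  by rewrite (negPf pw) (negPf (sw : s.[w] != 0)).
have [d d0 dP] : exists2 d : R, 0 < d & forall x : Cplx R, normc (x - w) < d ->
    normc (s.[x] - s.[w]) < normc a / normc (zeta ^+ k).
  by apply: poly_eps_delta; rewrite divr_gt0.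
have nz1 : 0 < normc zeta + 1 by rewrite ltr_wpDl // normc_ge0.
(* [t <= 1] keeps [1 - t ^+ k] nonnegative; the other bound keeps [x] close
   enough to [w] for both [e] and the continuity of [s]. *)
pose t := Order.min 1 (Order.min e d / (normc zeta + 1)).
have med : 0 < Order.min e d by rewrite lt_min e0 d0.
have t0 : 0 < t by rewrite lt_min ltr01 divr_gt0.
have t1 : t <= 1 by rewrite ge_min lexx.
pose x : Cplx R := w + t%:C%C * zeta.
have xw : normc (x - w) < Order.min e d.
  rewrite /x addrC addKr ComplexField.Normc.normcM normc_real gtr0_norm //.
  have tle : t <= Order.min e d / (normc zeta + 1) by rewrite ge_min lexx orbT.
  apply: lt_le_trans (_ : t * (normc zeta + 1) <= _).
    by rewrite ltr_pM2l // ltrDl.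
  by rewrite -ler_pdivlMr.
move: xw; rewrite lt_min => /andP[xe xd].
exists x => //; rewrite pE {2}/x addrAC subrr add0r exprMn.
have -> : a + s.[x] * (t%:C%C ^+ k * zeta ^+ k) =
   a * (1 - t ^+ k)%:C%C + (t ^+ k)%:C%C * (zeta ^+ k * (s.[x] - s.[w])).
  have -> : zeta ^+ k * (s.[x] - s.[w]) = zeta ^+ k * s.[x] + a.
    by rewrite mulrBr {2}zk divfK ?opprK.
  rewrite rmorphB rmorph1 -(rmorphXn (real_complex R)) /=.
  move: (zeta ^+ k) (_%:C)%C => Z T; ring.
apply: le_lt_trans (le_normcD _ _) _.
rewrite !ComplexField.Normc.normcM !normc_real.
have tk0 : 0 < t ^+ k by rewrite exprn_gt0.
rewrite (ger0_norm (_ : 0 <= 1 - t ^+ k)); last by rewrite subr_ge0 exprn_ile1 // ltW.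
rewrite (gtr0_norm tk0) mulrBr mulr1 -addrA gtrDl addrC subr_lt0.
rewrite [ltRHS]mulrC ltr_pM2l // mulrC -ltr_pdivlMr //.
exact: dP.
Qed.

End MinimumModulus.

(** * The Euclidean norm on pairs and roots of polynomials *)

Section SkewPolynomials.
Variable R : realType.
Implicit Types (z w : Cplx R) (p q : Cplx R * Cplx R) (r e : R).

Lemma sqr_euclid_norm p : euclid_norm p ^+ 2 = normc p.1 ^+ 2 + normc p.2 ^+ 2.
Proof. by rewrite sqr_sqrtr // addr_ge0 // sqr_ge0. Qed.

Lemma euclid_norm_ge0 p : 0 <= euclid_norm p.
Proof. exact: sqrtr_ge0. Qed.

Lemma le_euclid_norm p r : 0 <= r ->
  (euclid_norm p <= r) = (normc p.1 ^+ 2 + normc p.2 ^+ 2 <= r ^+ 2).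
Proof.
by move=> r0; rewrite -sqr_euclid_norm ler_pXn2r // ?nnegrE ?euclid_norm_ge0.
Qed.

Lemma normc1_le_euclid p : normc p.1 <= euclid_norm p.
Proof.
rewrite -(@ler_pXn2r _ 2) // ?nnegrE ?euclid_norm_ge0 ?normc_ge0 //.
by rewrite sqr_euclid_norm lerDl sqr_ge0.
Qed.

Lemma normc2_le_euclid p : normc p.2 <= euclid_norm p.
Proof.
rewrite -(@ler_pXn2r _ 2) // ?nnegrE ?euclid_norm_ge0 ?normc_ge0 //.
by rewrite sqr_euclid_norm lerDr sqr_ge0.
Qed.

Lemma continuous_fst2 : continuous (fun p => p.1 : Cplx R).
Proof. by move=> p; exact: cvg_fst. Qed.

Lemma continuous_snd2 : continuous (fun p => p.2 : Cplx R).
Proof. by move=> p; exact: cvg_snd. Qed.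

Lemma continuous_comp_T (S T U : topologicalType) (f : S -> T) (g : T -> U) :
  continuous f -> continuous g -> continuous (fun x => g (f x)).
Proof. by move=> cf cg x; apply: continuous_comp; [exact: cf|exact: cg]. Qed.

Lemma continuous_euclid (T : topologicalType) (f : T -> Cplx R * Cplx R) :
  continuous (fun t => (f t).1 : Cplx R) -> continuous (fun t => (f t).2 : Cplx R) ->
  continuous (fun t => euclid_norm (f t) : R^o).
Proof.
move=> c1 c2.
have c1' := continuous_comp_T c1 (@continuous_normc R).
have c2' := continuous_comp_T c2 (@continuous_normc R).
have c12 : continuous (fun t =>
    normc (f t).1 * normc (f t).1 + normc (f t).2 * normc (f t).2 : R^o).
  move=> t; apply: (@continuousD _ R^o T); apply: (@continuousM R T);
    by [exact: c1'|exact: c2'].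
apply: (@continuous_comp_T _ _ _ _ (fun x : R^o => Num.sqrt x : R^o) c12).
exact: sqrt_continuous.
Qed.

Lemma continuous_euclid_norm : continuous (fun p => euclid_norm p : R^o).
Proof. exact: (continuous_euclid continuous_fst2 continuous_snd2). Qed.

Lemma closed_cball r : closed (@cball R r).
Proof.
apply: (@closed_comp _ _ (fun p => euclid_norm p : R^o) [set x | x <= r]).
  by move=> p _; exact: continuous_euclid_norm.
exact: closed_le.
Qed.

Lemma compact_cball r : compact (@cball R r).
Proof.
apply: (@subclosed_compact _ _
  ([set z : Cplx R | normc z <= r] `*` [set z : Cplx R | normc z <= r])).
- exact: closed_cball.
- by apply: compact_setX; exact: compact_normc_ball.
- move=> p pr; split => /=.
    exact: le_trans (normc1_le_euclid p) pr.
  exact: le_trans (normc2_le_euclid p) pr.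
Qed.

Lemma compact_normc_disk w r : compact [set z : Cplx R | normc (z - w) <= r].
Proof.
apply: (subclosed_compact _ (@compact_normc_ball R (r + normc w))).
- have cf : continuous (fun z : Cplx R => z - w : Cplx R).
    apply: continuous_CplxD; last exact: (@cst_continuous (Cplx R) (Cplx R)).
    by move=> z A.
  apply: (@closed_comp _ _ (fun z : Cplx R => normc (z - w) : R^o) [set x | x <= r]).
    by move=> z _; exact: (continuous_comp_T cf (@continuous_normc R)).
  exact: closed_le.
- move=> z /= zr; rewrite -(subrK w z).
  by apply: le_trans (le_normcD _ _) _; rewrite lerD2r.
Qed.

(** The modulus of [h] attains its minimum over the closed disk away from the
    circle, and a nonzero minimum could be decreased. *)
Lemma poly_root_in_disk (h : {poly R[i]}) w r : 0 < r ->
  (forall z, normc (z - w) = r -> normc h.[w] < normc h.[z]) ->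
  exists2 z : Cplx R, normc (z - w) < r & h.[z] = 0.
Proof.
move=> r0 hr; pose D := [set z : Cplx R | normc (z - w) <= r].
have Dw : D w by rewrite /D /= subrr ComplexField.Normc.normc0 ltW.
have cN : {within D, continuous (fun z : Cplx R => normc h.[z] : R^o)}.
  apply: continuous_subspaceT.
  exact: (continuous_comp_T (@continuous_poly R h) (@continuous_normc R)).
have [|z0 /set_mem Dz0 z0min] := compact_EVT_min _ (@compact_normc_disk w r) cN.
  by exists w.
have hw : normc h.[z0] <= normc h.[w] by apply: z0min; exact/mem_set.
have z0r : normc (z0 - w) < r.
  rewrite lt_neqAle Dz0 andbT; apply/eqP => /hr.
  by rewrite ltNge hw.
exists z0 => //; apply/eqP; apply: contrapT => /negP hz0.
have sh : (1 < size h)%N.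
  rewrite ltnNge; apply/negP => /size1_polyC hE.
  have : normc ((w + r%:C%C) - w : Cplx R) = r.
    by rewrite addrC addKr normc_real gtr0_norm.
  by move=> /hr; rewrite hE !hornerC ltxx.
have [|z zz0 zlt] := poly_smaller_modulus sh hz0 (e := r - normc (z0 - w)).
  by rewrite subr_gt0.
have Dz : D z.
  rewrite /D /= -(subrK z0 z) -addrA; apply: le_trans (le_normcD _ _) _.
  by rewrite -lerBrDr ltW.
by have := z0min z (mem_set Dz); rewrite leNgt zlt.
Qed.

(** Zeros are isolated: after factoring out ['X - w], the cofactor does not
    vanish near [w]. *)
Lemma poly_nonzero_circle (h : {poly R[i]}) w e : h != 0 -> 0 < e ->
  exists2 r : R, 0 < r < e & forall z, normc (z - w) = r -> h.[z] != 0.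
Proof.
move=> h0 e0; have [m [s]] := multiplicity_XsubC h w.
rewrite h0 /= => sw hE.
have [d d0 dP] : exists2 d : R, 0 < d & forall z, normc (z - w) < d -> s.[z] != 0.
  have Nsw : 0 < normc s.[w].
    rewrite lt_neqAle normc_ge0 andbT eq_sym; apply/eqP.
    by move/ComplexField.Normc.eq0_normc/eqP; apply/negP.
  have [d d0 dP] := poly_eps_delta s w Nsw.
  exists d => // z /dP /=; apply: contraTneq => ->.
  by rewrite sub0r normcN ltxx.
have m0 : 0 < Order.min e d by rewrite lt_min e0.
exists (Order.min e d / 2).
  rewrite divr_gt0 //= ltr_pdivrMr // (le_lt_trans (_ : _ <= e)) ?ge_min ?lexx //.
  by rewrite ltr_pMr // ltr1n.
move=> z zr; rewrite hE !hornerE mulf_neq0 //.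
  apply: dP; rewrite zr ltr_pdivrMr // (le_lt_trans (_ : _ <= d)) ?ge_min ?lexx ?orbT //.
  by rewrite ltr_pMr // ltr1n.
rewrite expf_neq0 //; apply: contraTneq m0 => zw.
move: zr; rewrite zw ComplexField.Normc.normc0 => /esym/eqP.
by rewrite mulf_eq0 invr_eq0 pnatr_eq0 orbF => /eqP ->; rewrite ltxx.
Qed.

End SkewPolynomials.

(** * Zeros of fibrewise polynomial maps *)

Section SkewZeros.
Variable R : realType.
Implicit Types (z w : Cplx R) (p q : Cplx R * Cplx R) (r e : R).

Variables (G : {poly R[i]}) (H : Cplx R -> {poly R[i]}).
Variables (U : set (Cplx R * Cplx R)).

Let Phi p : Cplx R * Cplx R := (G.[p.1], (H p.1).[p.2]).

(** If [H q.1] were constant, [Phi] would be constant on the vertical line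
    through [q], which would therefore never meet the boundary of [U]; but [U]
    is bounded, as a point of the line maximising the real part of [w] shows. *)
Lemma skew_min_slice_nonconstant (e : R) q : open U -> compact (closure U) ->
  (forall p, closure U p -> ~ U p -> e <= euclid_norm (Phi p)) ->
  U q -> euclid_norm (Phi q) < e -> (1 < size (H q.1))%N.
Proof.
move=> oU cU bU Uq qe; rewrite ltnNge; apply/negP => /size1_polyC HE.
pose S := closure U `&` [set p | p.1 = q.1].
have cS : compact S.
  apply: compact_closedI => //.
  apply: (@closed_comp _ _ (fun p => p.1 : Cplx R) [set q.1]).
    by move=> p _; exact: continuous_fst2.
  exact: accessible_closed_set1 (hausdorff_accessible (@Cplx_hausdorff R)) _.
have cRe : continuous (fun p => complex.Re p.2 : R^o).
  move=> p A /nbhs_ballP[d /= d0 dA]; apply/nbhs_Cplx2P; exists d => // p' _ p2.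
  apply/dA/(le_lt_trans _ p2); rewrite -normcN opprB.
  have -> : complex.Re p.2 - complex.Re p'.2 = complex.Re (p.2 - p'.2).
    by case: (p.2) (p'.2) => a b [].
  exact: normc_Re.
have S0 : S !=set0 by exists q; split=> //; exact: subset_closure.
have [m /set_mem[Um mq] mmax] := compact_EVT_max S0 cS (continuous_subspaceT cRe).
have Phim : forall w, Phi (q.1, w) = Phi q.
  by move=> w; rewrite /Phi /= HE !hornerC.
have Uim : U m.
  apply: contrapT => nUm; have := bU _ Um nUm.
  by rewrite [m]surjective_pairing mq Phim leNgt qe.
have /nbhs_Cplx2P[d d0 dU] : nbhs m U by exact: open_nbhs_nbhs.
pose m' : Cplx R * Cplx R := (m.1, m.2 + (d / 2)%:C%C).
have d20 : 0 < d / 2 by rewrite divr_gt0.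
have Um' : U m'.
  apply: dU => /=; first by rewrite subrr ComplexField.Normc.normc0.
  rewrite addrC addKr normc_real gtr0_norm // ltr_pdivrMr // ltr_pMr //.
  by rewrite ltr1n.
have Sm' : S m' by split; [exact: subset_closure|exact: mq].
have := mmax m' (mem_set Sm'); rewrite leNgt => /negP; apply.
by rewrite /m' /=; case: (m.2) => a b /=; rewrite ltrDl.
Qed.

(** A minimum [q] of [|Phi|] over the closure of [U] lies in [U].  The fibre
    polynomial vanishes there, for otherwise its modulus could be decreased.
    On a small circle around [q.2] it does not vanish, so nearby fibre
    polynomials still have a root in the disk; moving to such a root while
    decreasing the modulus of [G] contradicts minimality unless [G.[q.1] = 0]. *)
Lemma skew_polynomial_zero e p0 :
  (1 < size G)%N -> continuous (fun p => (H p.1).[p.2] : Cplx R) ->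
  open U -> compact (closure U) ->
  (forall p, closure U p -> ~ U p -> e <= euclid_norm (Phi p)) ->
  U p0 -> euclid_norm (Phi p0) < e ->
  exists q, [/\ U q, G.[q.1] = 0 & (H q.1).[q.2] = 0].
Proof.
move=> sG cH oU cU bU Up0 p0e.
have cPhi : continuous (fun p => euclid_norm (Phi p) : R^o).
  have cG : continuous (fun p => G.[p.1] : Cplx R).
    exact: (continuous_comp_T (@continuous_fst2 R) (@continuous_poly R G)).
  exact: (@continuous_euclid R _ Phi cG cH).
have U0 : closure U !=set0 by exists p0; exact: subset_closure.
have [q /set_mem Uq qmin] := compact_EVT_min U0 cU (continuous_subspaceT cPhi).
have qe : euclid_norm (Phi q) < e.
  by apply: le_lt_trans p0e; apply: qmin; apply/mem_set; exact: subset_closure.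
have {}Uq : U q by apply: contrapT => nUq; have := bU _ Uq nUq; rewrite leNgt qe.
have qminU p : U p -> euclid_norm (Phi q) <= euclid_norm (Phi p).
  by move=> Up; apply: qmin; apply/mem_set; exact: subset_closure.
have sH := skew_min_slice_nonconstant oU cU bU Uq qe.
have /nbhs_Cplx2P[d d0 dU] : nbhs q U by exact: open_nbhs_nbhs.
have le_sq p : normc G.[p.1] ^+ 2 + normc (H p.1).[p.2] ^+ 2 <
    normc G.[q.1] ^+ 2 + normc (H q.1).[q.2] ^+ 2 -> ~ U p.
  move=> lt_pq /qminU; rewrite leNgt => /negP; apply.
  by rewrite -(@ltr_pXn2r _ 2) // ?nnegrE ?euclid_norm_ge0 // !sqr_euclid_norm.
have Hq0 : (H q.1).[q.2] = 0.
  apply/eqP; apply: contrapT => /negP Hq0.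
  have [w wq wlt] := poly_smaller_modulus sH Hq0 d0.
  apply: (le_sq (q.1, w)) => /=.
    by rewrite ltrD2l ltr_pXn2r // nnegrE normc_ge0.
  by apply: dU => //=; rewrite subrr ComplexField.Normc.normc0.
exists q; split=> //; apply/eqP; apply: contrapT => /negP Gq0.
have H0 : H q.1 != 0 by rewrite -size_poly_gt0 ltnW.
have [r /andP[r0 rd] circ] := poly_nonzero_circle q.2 H0 d0.
pose C := [set w : Cplx R | normc (w - q.2) = r].
have cC : compact C.
  apply: (subclosed_compact _ (@compact_normc_disk R q.2 r)); last first.
    by move=> w; rewrite /C /= => ->.
  have cf : continuous (fun w : Cplx R => normc (w - q.2) : R^o).
    apply: (@continuous_comp_T _ (Cplx R) _ (fun w => w - q.2)).
      apply: continuous_CplxD; last exact: (@cst_continuous (Cplx R) (Cplx R)).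
      by move=> w A.
    exact: continuous_normc.
  apply: (@closed_comp _ _ (fun w : Cplx R => normc (w - q.2) : R^o) [set r]).
    by move=> w _; exact: cf.
  exact: closed_eq.
(* By compactness of the circle, the root of [H q.1] at [q.2] stays separated
   from it for all fibres over points near [q.1]. *)
have near_circ : \forall z \near q.1, C `<=`
    (fun w => normc (H z).[q.2] < normc (H z).[w]).
  have := (iffLR (compact_near_coveringP C)) cC (Cplx R) (nbhs q.1)
    (fun z w => normc (H z).[q.2] < normc (H z).[w]) _; apply => w Cw.
  have Hw : 0 < normc (H q.1).[w].
    rewrite lt_neqAle normc_ge0 andbT eq_sym; apply/eqP.
    move/ComplexField.Normc.eq0_normc/eqP; apply/negP; exact: circ.
  set s := normc (H q.1).[w] in Hw.
  have s2 : 0 < s / 2 by rewrite divr_gt0.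
  have ball_H w' : exists2 d, 0 < d & forall p, normc (p.1 - q.1) < d ->
      normc (p.2 - w') < d -> normc ((H p.1).[p.2] - (H q.1).[w']) < s / 2.
    apply/(@nbhs_Cplx2P _ (q.1, w') [set p | normc ((H p.1).[p.2] - (H q.1).[w']) < s / 2]).
    apply: (cH (q.1, w') [set y : Cplx R | normc (y - (H q.1).[w']) < s / 2]).
    by apply/nbhs_CplxP; exists (s / 2).
  have [d1 d10 d1P] := ball_H w.
  have [d2 d20 d2P] := ball_H q.2.
  have m0 : 0 < Order.min d1 d2 by rewrite lt_min d10.
  apply/(@nbhs_Cplx2P _ (w, q.1)); exists (Order.min d1 d2) => // -[w' z] /=.
  rewrite !lt_min => /andP[w1 w2] /andP[z1 z2].
  have := d1P (z, w') z1 w1; have := d2P (z, q.2) z2.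
  rewrite /= subrr ComplexField.Normc.normc0 Hq0 subr0 => /(_ d20) h2 h1.
  apply: (lt_trans h2).
  have := ler_normc_sub (H q.1).[w] (H z).[w']; rewrite normcB -/s => h3.
  by have := splitr s; lra.
have /nbhs_CplxP[d' d'0 d'P] := near_circ.
have m0 : 0 < Order.min d d' by rewrite lt_min d0.
have [z zq zlt] := poly_smaller_modulus sG Gq0 m0.
move: zq; rewrite lt_min => /andP[zd zd'].
have [w wq Hw0] := poly_root_in_disk r0 (d'P z zd').
apply: (le_sq (z, w)) => /=; last by apply: dU => //=; exact: lt_trans rd.
by rewrite Hw0 Hq0 ltrD2r ltr_pXn2r // nnegrE normc_ge0.
Qed.

End SkewZeros.

(** * Islands of locally uniform limits *)

Section Islands.
Variable R : realType.
Implicit Types (z w : Cplx R) (p q : Cplx R * Cplx R) (r e : R).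

(** A form of the triangle inequality that is linear in the two components of
    the difference. *)
Lemma euclid_norm_le_add p q :
  euclid_norm q <= euclid_norm p + (normc (q.1 - p.1) + normc (q.2 - p.2)).
Proof.
have d1 := normc_ge0 (q.1 - p.1); have d2 := normc_ge0 (q.2 - p.2).
have S0 := euclid_norm_ge0 p.
rewrite le_euclid_norm ?addr_ge0 //.
have q1 : normc q.1 <= normc p.1 + normc (q.1 - p.1).
  by rewrite -lerBlDl; exact: ler_normc_sub.
have q2 : normc q.2 <= normc p.2 + normc (q.2 - p.2).
  by rewrite -lerBlDl; exact: ler_normc_sub.
have x1 := normc1_le_euclid p; have x2 := normc2_le_euclid p.
have SE := sqr_euclid_norm p.
have n1 := normc_ge0 q.1; have n2 := normc_ge0 q.2.
have s1 : normc q.1 ^+ 2 <= (normc p.1 + normc (q.1 - p.1)) ^+ 2.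
  by rewrite ler_pXn2r // nnegrE ?addr_ge0 ?normc_ge0.
have s2 : normc q.2 ^+ 2 <= (normc p.2 + normc (q.2 - p.2)) ^+ 2.
  by rewrite ler_pXn2r // nnegrE ?addr_ge0 ?normc_ge0.
apply: le_trans (lerD s1 s2) _.
move: (normc p.1) (normc p.2) (normc (q.1 - p.1)) (normc (q.2 - p.2))
  (euclid_norm p) d1 d2 S0 x1 x2 SE => a b c d S d1 d2 S0 x1 x2 SE.
rewrite !sqrrD SE.
have := ler_wpM2r d1 x1; have := ler_wpM2r d2 x2; have := mulr_ge0 d1 d2.
have := mulr_ge0 S0 d1; have := mulr_ge0 S0 d2.
by rewrite !mulr2n mulrDr; lra.
Qed.

(** Scaling a point of the sphere by [1 + t] leaves the ball. *)
Lemma sphere_boundary r q : 0 < r -> euclid_norm q = r -> boundary (cball r) q.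
Proof.
move=> r0 qr; split; first by apply: subset_closure; rewrite /cball /= qr.
move=> /nbhs_Cplx2P[d d0 dP].
have r1 : 0 < r + 1 by rewrite ltr_wpDr.
pose t := d / (r + 1).
have t0 : 0 < t by rewrite divr_gt0.
have dist z : normc z <= r -> normc (z * (1 + t%:C%C) - z) < d.
  move=> zr; rewrite mulrDr mulr1 addrC addKr ComplexField.Normc.normcM.
  rewrite normc_real gtr0_norm // /t mulrA ltr_pdivrMr // mulrC ltr_pM2l //.
  by rewrite (le_lt_trans zr) // ltrDl.
have nt : normc (1 + t%:C%C : Cplx R) = 1 + t.
  by rewrite -(rmorph1 (real_complex R)) -rmorphD normc_real gtr0_norm // addr_gt0.
have := dP (q.1 * (1 + t%:C%C), q.2 * (1 + t%:C%C)).
rewrite /= !dist -?qr ?normc1_le_euclid ?normc2_le_euclid // => /(_ isT isT).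
rewrite /cball /= le_euclid_norm ?euclid_norm_ge0 //=.
rewrite !ComplexField.Normc.normcM nt !exprMn -mulrDl -sqr_euclid_norm qr.
apply/negP; rewrite -ltNge ltr_pMr ?exprn_gt0 // -[ltLHS](expr1n R 2).
by rewrite ltr_pXn2r ?nnegrE // ?ltrDl // addr_ge0 // ltW.
Qed.

Lemma continuous_locally_uniform_limit (f : Cplx R * Cplx R -> Cplx R) :
  (forall r e, 0 < e -> exists2 g : Cplx R * Cplx R -> Cplx R, continuous g &
     forall q, cball r q -> normc (f q - g q) <= e) ->
  continuous f.
Proof.
move=> fP p A /nbhs_CplxP[e e0 eA].
have e3 : 0 < e / 3 by rewrite divr_gt0.
have [g cg gP] := fP (euclid_norm p + 2) _ e3.
have /nbhs_Cplx2P[d d0 dP] :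
    nbhs p (g @^-1` [set y : Cplx R | normc (y - g p) < e / 3]).
  by apply: cg; apply/nbhs_CplxP; exists (e / 3).
apply/nbhs_Cplx2P; exists (Order.min d 1); first by rewrite lt_min d0 ltr01.
move=> q; rewrite !lt_min => /andP[q1 q1'] /andP[q2 q2']; apply: eA.
have pq : cball (euclid_norm p + 2) q.
  by apply: le_trans (euclid_norm_le_add p q) _; lra.
have pp : cball (euclid_norm p + 2) p by rewrite /cball /= lerDl.
have h1 := gP q pq; have h2 := gP p pp; have h3 := dP q q1 q2; rewrite /= in h3.
have -> : f q - f p = (f q - g q) + (g q - g p) + (g p - f p) by ring.
apply: le_lt_trans (le_normcD _ _) _; rewrite [normc (g p - f p)]normcB.
have := le_normcD (f q - g q) (g q - g p); lra.
Qed.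

(** If the component of [p] avoided [Z], a clopen part of the sublevel set
    would contain [p] and avoid both [Z] and the sphere.  Thicken it to an open
    [U] whose closure meets neither the rest of the sublevel set nor the
    sphere: [|F|] exceeds [delta] on the boundary of [U] by a definite amount,
    so a close enough approximation has a zero in [U].  That zero is in [Z],
    hence in the sublevel set, hence in the clopen part. *)
Lemma component_meets_zeros (F : Cplx R * Cplx R -> Cplx R * Cplx R)
    (Z : set (Cplx R * Cplx R)) r delta p :
  0 < r ->
  continuous (fun q => (F q).1 : Cplx R) -> continuous (fun q => (F q).2 : Cplx R) ->
  closed Z ->
  (forall e, 0 < e -> exists G : {poly R[i]}, exists H : Cplx R -> {poly R[i]},
    [/\ (1 < size G)%N, continuous (fun q => (H q.1).[q.2] : Cplx R),
        forall q, cball r q -> normc ((F q).1 - G.[q.1]) <= e /\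
                               normc ((F q).2 - (H q.1).[q.2]) <= e &
        forall q, cball r q -> G.[q.1] = 0 -> (H q.1).[q.2] = 0 -> Z q]) ->
  sublevel F r delta p ->
  connected_component (sublevel F r delta) p `&` boundary (cball r) = set0 ->
  (forall q, Z q -> cball r q -> sublevel F r delta q) ->
  connected_component (sublevel F r delta) p `&` Z !=set0.
Proof.
move=> r0 cF1 cF2 clZ approx Xp Ib Zsub; set X := sublevel F r delta in Xp Ib *.
have cN := continuous_euclid cF1 cF2.
have clX : closed X.
  apply: closedI; last exact: closed_cball.
  apply: (@closed_comp _ _ (fun q => euclid_norm (F q) : R^o) [set x | x <= delta]).
    by move=> q _; exact: cN.
  exact: closed_le.
have ballr q : cball r q -> (cball (r + 1) : set (Cplx R * Cplx R))° q.
  move=> qr; apply/nbhs_Cplx2P; exists (1 / 2) => [|q' q1 q2]; first by lra.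
  apply: le_trans (euclid_norm_le_add q q') _; move: qr; rewrite /cball /=; lra.
have XK : X `<=` (cball (r + 1))° by move=> q [_ /ballr].
pose S := [set q | euclid_norm q = r].
have clS : closed S.
  apply: (@closed_comp _ _ (fun q => euclid_norm q : R^o) [set r]).
    by move=> q _; exact: continuous_euclid_norm.
  exact: closed_eq.
apply: contrapT => /set0P/negP; rewrite negbK => /eqP IZ.
have [|V [[clV VX clXV] Vp VZ]] :=
  clopen_part_avoiding (@Cplx2_hausdorff R) (@compact_cball R (r + 1)) XK clX
    (closedU clZ clS) Xp.
  apply/seteqP; split=> // q [Iq [Zq|Sq]]; first by rewrite -IZ.
  by rewrite -Ib; split=> //; exact: sphere_boundary.
pose B := (X `\` V) `|` [set q | r <= euclid_norm q].
have clB : closed B.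
  apply: closedU => //.
  apply: (@closed_comp _ _ (fun q => euclid_norm q : R^o) [set x | r <= x]).
    by move=> q _; exact: continuous_euclid_norm.
  exact: closed_ge.
have VB : V `&` B = set0.
  apply/seteqP; split=> // q [Vq [[_ /(_ Vq)]//|/= rq]].
  suff : (V `&` (Z `|` S)) q by rewrite VZ.
  split=> //; right; apply/eqP; rewrite eq_le rq andbT.
  by have [] := VX _ Vq.
have [U [oU VU UB]] := compact_normal_open (@Cplx2_hausdorff R)
  (@compact_cball R (r + 1)) (subset_trans VX XK) clV clB VB.
have Ur q : closure U q -> cball r q.
  move=> Uq; rewrite /cball /= leNgt; apply/negP => /ltW rq.
  suff : (closure U `&` B) q by rewrite UB.
  by split=> //; right.
have cU : compact (closure U).
  by apply: (subclosed_compact _ (@compact_cball R r)) => //; exact: closed_closure.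
have Ud q : closure U q -> ~ U q -> delta < euclid_norm (F q).
  move=> Uq nUq; rewrite ltNge; apply/negP => Fq.
  have : (closure U `&` B) q; last by rewrite UB.
  split=> //; left; split; last by move=> /VU.
  by split=> //; exact: Ur.
have [mu dmu muP] : exists2 mu, delta < mu &
    forall q, closure U q -> ~ U q -> mu <= euclid_norm (F q).
  have [[q0 [Uq0 nUq0]]|empty] := pselect (closure U `&` ~` U !=set0); last first.
    exists (delta + 1); first by rewrite ltrDl.
    by move=> q Uq nUq; exfalso; apply: empty; exists q.
  have cbU : compact (closure U `&` ~` U).
    by apply: compact_closedI => //; exact: open_closedC.
  have ne : closure U `&` ~` U !=set0 by exists q0.
  have [m /set_mem[Um nUm] mP] := compact_EVT_min ne cbU (continuous_subspaceT cN).
  exists (euclid_norm (F m)); first exact: Ud.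
  by move=> q Uq nUq; apply: mP; exact/mem_set.
(* Each comparison of [F] with [Phi] costs [2 * e], and both together must
   stay below the gap [mu - delta]. *)
pose e := (mu - delta) / 5.
have e0 : 0 < e by rewrite /e; lra.
have [G [H [sG cH appr GHZ]]] := approx e e0.
pose Phi q : Cplx R * Cplx R := (G.[q.1], (H q.1).[q.2]).
have close q : cball r q -> euclid_norm (F q) <= euclid_norm (Phi q) + 2 * e /\
    euclid_norm (Phi q) <= euclid_norm (F q) + 2 * e.
  move=> /appr[a1 a2].
  have := euclid_norm_le_add (Phi q) (F q).
  have := euclid_norm_le_add (F q) (Phi q).
  by rewrite /= normcB [normc (_.[q.2] - _)]normcB; lra.
have [] := @skew_polynomial_zero R G H U (mu - 2 * e) p sG cH oU cU.
- move=> q Uq nUq; have := muP q Uq nUq; have [] := close q (Ur q Uq).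
  by rewrite -/(Phi q); lra.
- exact: VU.
- have [Fp pr] := Xp; have [_] := close p pr; rewrite -/(Phi p).
  have eE : 5 * e = mu - delta by rewrite /e mulrC divfK // pnatr_eq0.
  by move: Fp; rewrite /=; lra.
move=> q [Uq G0 H0].
have qr : cball r q by apply: Ur; exact: subset_closure.
have Zq := GHZ q qr G0 H0.
have [Vq|nVq] := pselect (V q).
  suff : (V `&` (Z `|` S)) q by rewrite VZ.
  by split=> //; left.
have : (closure U `&` B) q; last by rewrite UB.
split; first exact: subset_closure.
by left; split=> //; exact: Zsub.
Qed.

End Islands.

(** * The products over the powers of two *)

Section WeierstrassProducts.
Variable R : realType.
Implicit Types (z w : Cplx R) (P : pred nat) (n k : nat).

(** Both [g] and [g_k] are limits of such products, for [P] true everywhere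
    and for [P i := i != k]. *)
Definition dyadic_prod P n z : Cplx R :=
  \prod_(1 <= i < n.+1 | P i) (1 - z / 2 ^+ i).

Definition dyadic_poly P n : {poly R[i]} :=
  \prod_(1 <= i < n.+1 | P i) (1 - (2 ^- i)%:P * 'X).

Lemma horner_dyadic_poly P n z : (dyadic_poly P n).[z] = dyadic_prod P n z.
Proof.
rewrite /dyadic_poly horner_prod; apply: eq_bigr => i _.
by rewrite !hornerE mulrC.
Qed.

Lemma dyadic_prod0 P z : dyadic_prod P 0 z = 1.
Proof. by rewrite /dyadic_prod big_geq. Qed.

Lemma dyadic_prodS P n z :
  dyadic_prod P n.+1 z = dyadic_prod P n z * (if P n.+1 then 1 - z / 2 ^+ n.+1 else 1).
Proof. by rewrite /dyadic_prod big_mkcond big_nat_recr //= -big_mkcond. Qed.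

Lemma normc_expn2 n : normc (2 ^+ n : Cplx R) = 2 ^+ n.
Proof. by rewrite normcX normc_nat. Qed.

Lemma normc_div_expn2 z n : normc (z / 2 ^+ n) = normc z / 2 ^+ n.
Proof.
by rewrite ComplexField.Normc.normcM ComplexField.Normc.normcV normc_expn2.
Qed.

(** Each factor is at most [expR (normc z / 2 ^+ i)]; the exponents sum to
    [normc z * (1 - 1 / 2 ^+ n)]. *)
Lemma dyadic_prod_bound P n z :
  normc (dyadic_prod P n z) <= expR (normc z * (1 - 1 / 2 ^+ n)).
Proof.
elim: n => [|n IH].
  by rewrite dyadic_prod0 ComplexField.Normc.normc1 expr0 divr1 subrr mulr0 expR0.
rewrite dyadic_prodS ComplexField.Normc.normcM.
have -> : normc z * (1 - 1 / 2 ^+ n.+1) =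
    normc z * (1 - 1 / 2 ^+ n) + normc z / 2 ^+ n.+1.
  rewrite exprS; have : 2 ^+ n != 0 :> R by rewrite expf_neq0.
  by move=> h; field.
rewrite expRD; apply: ler_pM => //; try exact: normc_ge0.
have h0 : 0 <= normc z / 2 ^+ n.+1 by rewrite divr_ge0 ?normc_ge0 ?exprn_ge0.
apply: le_trans (expR_ge1Dx _).
case: (P n.+1); last by rewrite ComplexField.Normc.normc1 lerDl.
apply: le_trans (le_normcD _ _) _.
by rewrite ComplexField.Normc.normc1 normcN normc_div_expn2.
Qed.

Lemma dyadic_prod_le P n z : normc (dyadic_prod P n z) <= expR (normc z).
Proof.
apply: le_trans (dyadic_prod_bound P n z) _; rewrite ler_expR.
rewrite -[leRHS]mulr1 ler_wpM2l ?normc_ge0 // gerBl divr_ge0 // exprn_ge0 //.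
Qed.

Lemma dyadic_prod_increment P z n :
  normc (dyadic_prod P n.+1 z - dyadic_prod P n z) <= expR (normc z) * normc z / 2 ^+ n.
Proof.
rewrite dyadic_prodS -[X in _ - X]mulr1 -mulrBr ComplexField.Normc.normcM -mulrA.
apply: ler_pM; rewrite ?normc_ge0 ?dyadic_prod_le //.
have h0 : 0 <= normc z / 2 ^+ n by rewrite divr_ge0 ?normc_ge0 ?exprn_ge0.
case: (P n.+1); last by rewrite subrr ComplexField.Normc.normc0.
rewrite addrAC subrr add0r normcN normc_div_expn2.
rewrite ler_wpM2l ?normc_ge0 // lef_pV2 ?posrE ?exprn_gt0 //.
by rewrite ler_eXn2l // ltr1n.
Qed.

Lemma limn_geometric (u : nat -> Cplx R) (B : R) :
  (forall n, normc (u n.+1 - u n) <= B / 2 ^+ n) ->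
  forall n, normc ((limn u : Cplx R) - u n) <= 4 * B / 2 ^+ n.
Proof.
move=> /geometric_limit[l lP] n.
have -> : limn u = l :> Cplx R.
  exact: (@cvg_lim (Cplx R) (@Cplx_hausdorff R) _ _ _ _ _ (geometric_cvg lP)).
exact: lP.
Qed.

Definition dyadic_lim P z : Cplx R := limn (fun n => dyadic_prod P n z).

Lemma dyadic_lim_approx P n z :
  normc (dyadic_lim P z - dyadic_prod P n z) <= 4 * (expR (normc z) * normc z) / 2 ^+ n.
Proof. by apply: limn_geometric; exact: dyadic_prod_increment. Qed.

Lemma dyadic_lim_le P z :
  normc (dyadic_lim P z) <= 1 + 4 * (expR (normc z) * normc z).
Proof.
rewrite -(subrK (dyadic_prod P 0 z) (dyadic_lim P z)) dyadic_prod0 addrC.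
apply: le_trans (le_normcD _ _) _; rewrite ComplexField.Normc.normc1 lerD2l.
by have := dyadic_lim_approx P 0 z; rewrite dyadic_prod0 expr0 divr1.
Qed.

Lemma dyadic_factor_eq0 z i : (1 - z / 2 ^+ i == 0) = (z == 2 ^+ i).
Proof.
rewrite subr_eq0 eq_sym -[RHS](inj_eq (@mulIf _ (2 ^- i : R[i]) _)).
  by rewrite divff // expf_neq0 // pnatr_eq0.
by rewrite invr_eq0 expf_neq0 // pnatr_eq0.
Qed.

Lemma dyadic_prod_eq0P P n z :
  reflect (exists k, [/\ (1 <= k <= n)%N, P k & z = 2 ^+ k]) (dyadic_prod P n z == 0).
Proof.
apply: (iffP idP) => [|[k [kn Pk ->]]].
  rewrite /dyadic_prod prodf_seq_eq0 => /hasP[k].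
  rewrite mem_index_iota ltnS => kn /andP[Pk]; rewrite dyadic_factor_eq0 => /eqP zk.
  by exists k.
rewrite /dyadic_prod prodf_seq_eq0; apply/hasP; exists k.
  by rewrite mem_index_iota ltnS.
by rewrite Pk dyadic_factor_eq0 eqxx.
Qed.

Lemma expn2_inj (i j : nat) : (2 ^+ i : R[i]) = 2 ^+ j -> i = j.
Proof.
move=> /(congr1 (fun x : Cplx R => normc x)); rewrite !normc_expn2.
by apply: ieexprIn; rewrite ?ltr0n // pnatr_eq1.
Qed.

(** The factor of index [i < k] is at most [2 ^ (k - i)] in modulus and those
    with [i > k] are at most [1].  Squaring avoids halving the exponent
    [k * k.-1]; the induction on [n] carries the exponent that the remaining
    factors may still contribute. *)
Lemma dyadic_prod_at_expn2 k n :
  normc (dyadic_prod (fun i => i != k) n (2 ^+ k)) ^+ 2 <= 2 ^+ (k * k.-1).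
Proof.
suff : normc (dyadic_prod (fun i => i != k) n (2 ^+ k)) ^+ 2
    * 2 ^+ ((k - n) * (k - n).-1) <= 2 ^+ (k * k.-1).
  apply: le_trans; rewrite ler_peMr ?exprn_ge0 ?normc_ge0 //.
  by rewrite exprn_ege1 // ler1n.
elim: n => [|n IH].
  by rewrite dyadic_prod0 ComplexField.Normc.normc1 expr1n mul1r subn0.
apply: le_trans IH.
rewrite dyadic_prodS ComplexField.Normc.normcM exprMn -mulrA.
apply: ler_wpM2l; first by rewrite exprn_ge0 // normc_ge0.
have [kn|nk] := leqP k n.+1.
  rewrite (_ : (k - n.+1 = 0)%N) ?mul0n ?expr0 ?mulr1; last by lia.
  rewrite (@le_trans _ _ 1) ?exprn_ege1 ?ler1n // exprn_ile1 ?normc_ge0 //.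
  have [->|kn'] := eqVneq n.+1 k; first by rewrite ComplexField.Normc.normc1.
  have -> : (1 - 2 ^+ k / 2 ^+ n.+1 : R[i]) = (1 - 1 / 2 ^+ (n.+1 - k) : R)%:C%C.
    rewrite rmorphB rmorph1 /= -(subnK kn) addnK exprD invfM mulrCA divff.
      by rewrite mul1r mulr1 fmorphV rmorphXn /= rmorph_nat.
    by rewrite expf_neq0 // pnatr_eq0.
  rewrite normc_real ger0_norm ?gerBl ?divr_ge0 ?exprn_ge0 //.
  by rewrite subr_ge0 ler_pdivrMr ?exprn_gt0 // mul1r exprn_ege1 // ler1n.
have nk' : (n.+1 != k) by rewrite neq_ltn nk.
rewrite nk'.
have -> : (1 - 2 ^+ k / 2 ^+ n.+1 : R[i]) = (1 - 2 ^+ (k - n.+1) : R)%:C%C.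
  rewrite rmorphB rmorph1 /= -{1}(subnK (ltnW nk)) exprD mulfK.
    by rewrite rmorphXn /= rmorph_nat.
  by rewrite expf_neq0 // pnatr_eq0.
rewrite normc_real.
have e1 : 1 <= 2 ^+ (k - n.+1) :> R by rewrite exprn_ege1 // ler1n.
have le1 : `|1 - 2 ^+ (k - n.+1)| <= 2 ^+ (k - n.+1) :> R by rewrite ler_norml; lra.
apply: le_trans (_ : (2 ^+ (k - n.+1)) ^+ 2 * 2 ^+ ((k - n.+1) * (k - n.+1).-1) <= _).
  by rewrite ler_wpM2r ?exprn_ge0 // ler_pXn2r ?nnegrE // exprn_ge0.
rewrite -exprM -exprD ler_eXn2l ?ltr1n //.
have -> : (k - n = (k - n.+1).+1)%N by lia.
by case: (k - n.+1)%N => [|m] /=; lia.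
Qed.

End WeierstrassProducts.

(** * The Cornalba-Shiffman map and its truncations *)

Section CornalbaShiffmanMap.
Variable R : realType.
Variable c : nat -> nat.
Hypothesis c_ge : forall i, (1 <= i)%N -> (i <= c i)%N.
Implicit Types (z w : Cplx R) (n k : nat).

Let gk k n z := dyadic_prod (fun i => i != k) n z.

Definition cs_P_poly (d : nat) : {poly R[i]} :=
  \prod_(1 <= j < d.+1) ('X - (j%:R^-1)%:P).

Lemma horner_cs_P_poly d w : (cs_P_poly d).[w] = cs_P d w.
Proof.
rewrite /cs_P_poly horner_prod; apply: eq_bigr => j _.
by rewrite !hornerE.
Qed.

Lemma cs_P_eq0P d w :
  reflect (exists2 j, (1 <= j <= d)%N & w = j%:R^-1) (cs_P d w == 0).
Proof.
apply: (iffP idP) => [|[j jd ->]]; rewrite /cs_P prodf_seq_eq0.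
  move=> /hasP[j]; rewrite mem_index_iota ltnS => jd /=; rewrite subr_eq0 => /eqP wj.
  by exists j.
by apply/hasP; exists j; rewrite ?mem_index_iota ?ltnS //= subrr eqxx.
Qed.

Lemma normc_cs_P d w : normc (cs_P d w) <= (1 + normc w) ^+ d.
Proof.
elim: d => [|d IH]; first by rewrite /cs_P big_geq // ComplexField.Normc.normc1.
rewrite /cs_P big_nat_recr //= -/(cs_P d w) ComplexField.Normc.normcM exprSr.
apply: ler_pM; rewrite ?normc_ge0 //.
apply: le_trans (le_normcD _ _) _; rewrite addrC lerD2r normcN.
rewrite ComplexField.Normc.normcV normc_nat invf_le1 ?ltr0n //.
by rewrite ler1n.
Qed.

(** The left-hand side times [2 ^+ d] is [(2 * (1 + x) / 2 ^+ d) ^+ d], whose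
    base is at most [1] once [d] is large. *)
Lemma superexponential_bound (x : R) : 0 <= x ->
  exists2 B : R, 0 <= B & forall d, (1 + x) ^+ d / 2 ^+ (d ^ 2) <= B / 2 ^+ d.
Proof.
move=> x0; have [N xN] := exists_expn2_gt (2 * (1 + x)).
have x1 : 1 <= 2 * (1 + x) by lra.
exists ((2 * (1 + x)) ^+ N); first by rewrite exprn_ge0 // (le_trans ler01).
move=> d; rewrite -[in leLHS](mulnn d) exprM.
have p1 : 0 < 2 ^+ d :> R by rewrite exprn_gt0.
have p2 : 0 < (2 ^+ d) ^+ d :> R by rewrite exprn_gt0.
rewrite ler_pdivrMr // mulrAC ler_pdivlMr // -exprMn [(1 + x) * 2]mulrC.
have [dN|Nd] := leqP d N.
  apply: le_trans (_ : (2 * (1 + x)) ^+ N <= _); first by rewrite ler_weXn2l.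
  by rewrite ler_peMr ?exprn_ge0 ?(le_trans ler01) // !exprn_ege1 // ler1n.
apply: le_trans (_ : (2 ^+ d) ^+ d <= _).
  rewrite ler_pXn2r ?(leq_ltn_trans (leq0n N) Nd) // ?nnegrE ?(ltW p1) ?(le_trans ler01) //.
  by rewrite (le_trans (ltW xN)) // ler_eXn2l ?ltr1n // ltnW.
by rewrite ler_peMl ?(ltW p2) // exprn_ege1.
Qed.

Definition cs_f_partial n z w : Cplx R :=
  \sum_(1 <= i < n.+1) 2 ^- (c i ^ 2) * cs_gk i z * cs_P (c i) w.

(** Truncates the products inside the summands as well as the sum, so that
    the result is a polynomial in [z] and in [w]. *)
Definition cs_f_approx n z w : Cplx R :=
  \sum_(1 <= i < n.+1) 2 ^- (c i ^ 2) * gk i n z * cs_P (c i) w.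

Definition cs_f_approx_poly n z : {poly R[i]} :=
  \sum_(1 <= i < n.+1) (2 ^- (c i ^ 2) * gk i n z) *: cs_P_poly (c i).

Lemma horner_cs_f_approx_poly n z w :
  (cs_f_approx_poly n z).[w] = cs_f_approx n z w.
Proof.
rewrite /cs_f_approx_poly horner_sum; apply: eq_bigr => i _.
by rewrite hornerZ horner_cs_P_poly.
Qed.

Lemma continuous_cs_f_approx n :
  continuous (fun q : Cplx R * Cplx R => cs_f_approx n q.1 q.2 : Cplx R).
Proof.
rewrite /cs_f_approx; elim: (index_iota 1 n.+1) => [|i s IH].
  under eq_fun do rewrite big_nil.
  exact: (@cst_continuous _ (Cplx R)).
under eq_fun do rewrite big_cons.
apply: continuous_CplxD; last exact: IH.
apply: continuous_CplxM; last first.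
  under eq_fun do rewrite -horner_cs_P_poly.
  exact: (continuous_comp_T (@continuous_snd2 R) (@continuous_poly R (cs_P_poly (c i)))).
apply: continuous_CplxM; first exact: (@cst_continuous _ (Cplx R)).
under eq_fun do rewrite /gk -horner_dyadic_poly.
exact: (continuous_comp_T (@continuous_fst2 R)
  (@continuous_poly R (dyadic_poly R (fun j => j != i) n))).
Qed.

Lemma normc_coef n : normc (2 ^- n : Cplx R) = 2 ^- n.
Proof. by rewrite ComplexField.Normc.normcV normc_expn2. Qed.

Lemma weight_bound (x B : R) i w : 0 <= x -> normc w <= x -> (1 <= i)%N ->
  0 <= B -> (forall d, (1 + x) ^+ d / 2 ^+ (d ^ 2) <= B / 2 ^+ d) ->
  2 ^- (c i ^ 2) * normc (cs_P (c i) w) <= B / 2 ^+ i.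
Proof.
move=> x0 wx i1 B0 BP.
apply: le_trans (_ : (1 + x) ^+ c i / 2 ^+ (c i ^ 2) <= _).
  rewrite mulrC ler_wpM2r ?invr_ge0 ?exprn_ge0 //.
  apply: le_trans (normc_cs_P _ _) _.
  by apply: lerXn2r; rewrite ?nnegrE ?addr_ge0 ?normc_ge0 // lerD2l.
apply: le_trans (BP _) _; rewrite ler_wpM2l // lef_pV2 ?posrE ?exprn_gt0 //.
by rewrite ler_eXn2l ?ltr1n // c_ge.
Qed.

Lemma geometric_sum_le (B : R) n : 0 <= B -> \sum_(1 <= i < n.+1) B / 2 ^+ i <= B.
Proof.
move=> B0; suff -> : \sum_(1 <= i < n.+1) B / 2 ^+ i = B - B / 2 ^+ n.
  by rewrite gerBl divr_ge0 // exprn_ge0.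
elim: n => [|n IH]; first by rewrite big_geq // expr0 divr1 subrr.
rewrite big_nat_recr //= IH exprS.
have : 2 ^+ n != 0 :> R by rewrite expf_neq0.
by move=> h; field.
Qed.

(** The error on [f] splits into the tail of the series and the errors made
    by truncating the products, weighted by the summable coefficients. *)
Lemma cs_map_approx (r : R) : 0 <= r -> exists K : R, forall n q, cball r q ->
  normc ((cs_map c q).1 - dyadic_prod predT n q.1) <= K / 2 ^+ n /\
  normc ((cs_map c q).2 - cs_f_approx n q.1 q.2) <= K / 2 ^+ n.
Proof.
move=> r0; have [B B0 BP] := superexponential_bound r0.
pose T := 4 * (expR r * r).
have e0 : 0 <= expR r * r by rewrite mulr_ge0 ?expR_ge0.
have T0 : 0 <= T by rewrite mulr_ge0.
have Tz z : normc z <= r -> 4 * (expR (normc z) * normc z) <= T.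
  by move=> zr; rewrite ler_wpM2l // ler_pM ?expR_ge0 ?normc_ge0 // ler_expR.
have pos n : 0 <= 2 ^- n :> R by rewrite invr_ge0 exprn_ge0.
have M0 : 0 <= 4 * ((1 + T) * B) by rewrite !mulr_ge0 // addr_ge0.
exists (T + 4 * ((1 + T) * B) + T * B) => n [z w] zw.
have zr : normc z <= r := le_trans (normc1_le_euclid (z, w)) zw.
have wr : normc w <= r := le_trans (normc2_le_euclid (z, w)) zw.
rewrite /=; split.
  apply: le_trans (dyadic_lim_approx predT n z) _; rewrite ler_wpM2r //.
  by have := Tz z zr; have := mulr_ge0 T0 B0; lra.
have step1 : normc (cs_f c z w - cs_f_partial n z w) <= 4 * ((1 + T) * B) / 2 ^+ n.
  apply: (@limn_geometric _ (fun m => cs_f_partial m z w)) => m.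
  rewrite /cs_f_partial big_nat_recr //= addrAC subrr add0r.
  rewrite !ComplexField.Normc.normcM normc_coef mulrAC mulrC -mulrA.
  apply: ler_pM; rewrite ?normc_ge0 ?mulr_ge0 ?normc_ge0 ?pos //.
    apply: le_trans (dyadic_lim_le _ z) _; rewrite lerD2l; exact: Tz.
  have /le_trans := @weight_bound r B m.+1 w r0 wr isT B0 BP; apply.
  rewrite ler_wpM2l // lef_pV2 ?posrE ?exprn_gt0 //.
  by rewrite ler_eXn2l // ltr1n.
have step2 : normc (cs_f_partial n z w - cs_f_approx n z w) <= T * B / 2 ^+ n.
  rewrite /cs_f_partial /cs_f_approx -sumrB.
  apply: le_trans (_ : \sum_(1 <= i < n.+1) (T / 2 ^+ n) * (B / 2 ^+ i) <= _); last first.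
    rewrite -mulr_sumr [leRHS]mulrAC; apply: ler_wpM2l; first exact: mulr_ge0.
    exact: geometric_sum_le.
  have : {in index_iota 1 n.+1, forall i, (1 <= i)%N}.
    by move=> i; rewrite mem_index_iota => /andP[].
  elim: (index_iota 1 n.+1) => [|i s IH] s1.
    by rewrite !big_nil ComplexField.Normc.normc0.
  rewrite !big_cons; apply: le_trans (le_normcD _ _) _; apply: lerD; last first.
    by apply: IH => j js; apply: s1; rewrite inE js orbT.
  rewrite -mulrBl -mulrBr !ComplexField.Normc.normcM normc_coef mulrAC mulrC.
  apply: ler_pM; rewrite ?normc_ge0 ?mulr_ge0 ?normc_ge0 ?pos //.
    apply: le_trans (dyadic_lim_approx _ n z) _.
    by rewrite ler_wpM2r // Tz.
  by apply: (weight_bound r0) => //; apply: s1; rewrite inE eqxx.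
have -> : cs_f c z w - cs_f_approx n z w =
    (cs_f c z w - cs_f_partial n z w) + (cs_f_partial n z w - cs_f_approx n z w).
  by rewrite addrA subrK.
apply: le_trans (le_normcD _ _) _; apply: le_trans (lerD step1 step2) _.
by rewrite -mulrDl ler_wpM2r // lerD2r lerDr.
Qed.

Lemma continuous_cs_map1 : continuous (fun q : Cplx R * Cplx R => (cs_map c q).1 : Cplx R).
Proof.
apply: continuous_locally_uniform_limit => r e e0.
have [K KP] := cs_map_approx (normr_ge0 r).
have [n Kn] := exists_geometric_lt K e0.
exists (fun q => dyadic_prod predT n q.1).
  under eq_fun do rewrite -horner_dyadic_poly.
  exact: (continuous_comp_T (@continuous_fst2 R) (@continuous_poly R (dyadic_poly R predT n))).
move=> q qr; have [|h _] := KP n q; last exact: le_trans h (ltW Kn).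
by apply: le_trans qr _; exact: ler_norm.
Qed.

Lemma continuous_cs_map2 : continuous (fun q : Cplx R * Cplx R => (cs_map c q).2 : Cplx R).
Proof.
apply: continuous_locally_uniform_limit => r e e0.
have [K KP] := cs_map_approx (normr_ge0 r).
have [n Kn] := exists_geometric_lt K e0.
exists (fun q => cs_f_approx n q.1 q.2); first exact: continuous_cs_f_approx.
move=> q qr; have [|_ h] := KP n q; last exact: le_trans h (ltW Kn).
by apply: le_trans qr _; exact: ler_norm.
Qed.

Lemma cs_f_approx_at_expn2 n k w : (1 <= k <= n)%N ->
  cs_f_approx n (2 ^+ k) w = 2 ^- (c k ^ 2) * gk k n (2 ^+ k) * cs_P (c k) w.
Proof.
move=> kn; rewrite /cs_f_approx (bigD1_seq k) ?iota_uniq ?mem_index_iota ?ltnS //=.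
rewrite big1 ?addr0 // => i ik.
have /eqP -> : gk i n (2 ^+ k) == 0.
  by apply/dyadic_prod_eq0P; exists k; rewrite eq_sym.
by rewrite mulr0 mul0r.
Qed.

Definition cs_zeros : set (Cplx R * Cplx R) :=
  [set q | exists k j, [/\ (1 <= k)%N, (1 <= j <= c k)%N & q = (2 ^+ k, j%:R^-1)]].

(** The zeros of the truncations are known exactly, because their products
    are finite; this spares any discussion of when the infinite products
    vanish. *)
Lemma cs_approx_zeros n q :
  dyadic_prod predT n q.1 = 0 -> cs_f_approx n q.1 q.2 = 0 -> cs_zeros q.
Proof.
case: q => z w /= /eqP/dyadic_prod_eq0P[k [kn _ ->]].
rewrite cs_f_approx_at_expn2 // => /eqP.
rewrite !mulf_eq0 invr_eq0 expf_eq0 pnatr_eq0 andbF /=.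
case/orP => [/dyadic_prod_eq0P[i [_ ik /expn2_inj ki]]|/cs_P_eq0P[j jc ->]].
  by rewrite ki eqxx in ik.
by exists k, j; case/andP: kn.
Qed.

(** Over [2 ^ k] the truncated product vanishes as soon as [k <= n], so that
    only the second component remains in the limit. *)
Lemma cs_map_at_expn2 k w (x : R) : (1 <= k)%N -> 0 <= x ->
  (forall n, (k <= n)%N -> normc (cs_f_approx n (2 ^+ k) w) <= x) ->
  euclid_norm (cs_map c (2 ^+ k, w)) <= x.
Proof.
move=> k1 x0 fx.
have [K KP] := cs_map_approx (euclid_norm_ge0 (2 ^+ k : Cplx R, w)).
have approx n : (k <= n)%N ->
    normc (cs_map c (2 ^+ k, w)).1 <= K / 2 ^+ n /\
    normc (cs_map c (2 ^+ k, w)).2 <= x + K / 2 ^+ n.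
  move=> kn; have [h1 h2] := KP n (2 ^+ k, w) (lexx _); move: h1 h2 => /=.
  have /eqP -> : dyadic_prod predT n (2 ^+ k : Cplx R) == 0.
    by apply/dyadic_prod_eq0P; exists k; rewrite k1.
  rewrite subr0 => h1 h2; split=> //.
  have := ler_normc_sub (cs_f c (2 ^+ k) w) (cs_f_approx n (2 ^+ k) w).
  by have := fx n kn; lra.
apply/ler_addgt0Pr => e e0; have e2 : 0 < e / 2 by rewrite divr_gt0.
have [N KN] := exists_geometric_lt K e2.
have K0 : 0 <= K.
  have [+ _] := approx k (leqnn k).
  move=> /(le_trans (normc_ge0 _)); rewrite pmulr_lge0 // invr_gt0 exprn_gt0 //.
have [h1 h2] := approx (maxn k N) (leq_maxl _ _).
have Kmax : K / 2 ^+ maxn k N <= K / 2 ^+ N.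
  rewrite ler_wpM2l // lef_pV2 ?posrE ?exprn_gt0 //.
  by rewrite ler_eXn2l ?ltr1n // leq_maxr.
have := euclid_norm_le_add (0, 0) (cs_map c (2 ^+ k, w)).
rewrite !subr0.
have -> : euclid_norm (0, 0) = 0 :> R.
  by rewrite /euclid_norm /= !(expr0n, addr0, sqrtr0).
by have := splitr e; lra.
Qed.

Lemma cs_map_zeros q : cs_zeros q -> euclid_norm (cs_map c q) = 0.
Proof.
move=> [k [j [k1 jc ->]]]; apply/eqP; rewrite eq_le euclid_norm_ge0 andbT.
apply: cs_map_at_expn2 => // n kn; rewrite cs_f_approx_at_expn2 ?k1 //.
have /eqP -> : cs_P (c k) (j%:R^-1 : Cplx R) == 0 by apply/cs_P_eq0P; exists j.
by rewrite mulr0 ComplexField.Normc.normc0.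
Qed.

(** With [d := c k] the square of the norm is at most
    [2 ^ (- 2 d ^ 2) * 2 ^ (d (d - 1)) * 2 ^ (d ^ 2) = 2 ^ (- d)]. *)
Lemma cs_map_slice_small k w (delta : R) : (1 <= k)%N -> 0 <= delta ->
  2 ^- c k <= delta ^+ 2 -> (1 + normc w) ^+ 2 <= 2 ^+ c k ->
  euclid_norm (cs_map c (2 ^+ k, w)) <= delta.
Proof.
move=> k1 d0 cd wc; apply: cs_map_at_expn2 => // n kn.
rewrite cs_f_approx_at_expn2 ?k1 //.
rewrite -(@ler_pXn2r _ 2) ?nnegrE ?normc_ge0 //; apply: le_trans cd.
rewrite !ComplexField.Normc.normcM normc_coef !exprMn exprVn.
have h1 : normc (gk k n (2 ^+ k)) ^+ 2 <= 2 ^+ (c k * (c k).-1).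
  apply: le_trans (dyadic_prod_at_expn2 R k n) _.
  rewrite ler_eXn2l ?ltr1n // leq_mul ?c_ge //.
  by have := c_ge k1; lia.
have h2 : normc (cs_P (c k) w) ^+ 2 <= 2 ^+ (c k * c k).
  rewrite exprM; apply: le_trans (_ : ((1 + normc w) ^+ c k) ^+ 2 <= _).
    rewrite ler_pXn2r ?nnegrE ?normc_ge0 ?exprn_ge0 ?addr_ge0 ?normc_ge0 //.
    exact: normc_cs_P.
  rewrite -exprM mulnC exprM.
  by apply: lerXn2r; rewrite ?nnegrE ?exprn_ge0 ?addr_ge0 ?normc_ge0.
apply: le_trans (_ : ((2 ^+ (c k ^ 2)) ^+ 2)^-1 * 2 ^+ (c k * (c k).-1) * 2 ^+ (c k * c k) <= _).
  apply: ler_pM => //.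
  - by rewrite mulr_ge0 ?invr_ge0 ?exprn_ge0 ?normc_ge0.
  - by rewrite exprn_ge0 // normc_ge0.
  - by rewrite ler_wpM2l // invr_ge0 !exprn_ge0.
rewrite -exprM -mulrA -exprD ler_pdivrMl ?exprn_gt0 // ler_pdivlMr ?exprn_gt0 //.
rewrite -exprD ler_eXn2l ?ltr1n //.
by have := leq_trans k1 (c_ge k1); case: (c k) => // m _ /=; rewrite -mulnn; nia.
Qed.

End CornalbaShiffmanMap.

(** * The number of islands *)

Lemma counting_le_size (T : choiceType) (R : realType) (A : set T) (s : seq T) :
  A `<=` [set` s] -> (counting A <= ((size s)%:R : R)%:E)%E.
Proof.
move=> As; have fA : finite_set A by apply: sub_finite_set As _; exact: finite_seq.
rewrite /counting asboolT // lee_fin ler_nat.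
apply: leq_trans (size_undup s); rewrite -card_fseq.
apply: fsubset_leq_card; apply/fsubsetP => x.
by rewrite in_fset_set // => /set_mem /As xs; rewrite !inE.
Qed.

Section CountingIslands.
Variable R : realType.
Variable c : nat -> nat.
Hypothesis c_ge : forall i, (1 <= i)%N -> (i <= c i)%N.
Implicit Types (z w : Cplx R) (n k : nat).

Local Notation F := (@cs_map R c).

(** The values [0] of [k] and [j] contribute points that need not be zeros;
    they are harmless in an upper bound. *)
Definition zeros_seq n : seq (Cplx R * Cplx R) :=
  flatten [seq [seq (2 ^+ k : Cplx R, j%:R^-1 : Cplx R) | j <- iota 0 (c k).+1]
          | k <- iota 0 n].

Lemma mem_zeros_seq n k j : (k < n)%N -> (j <= c k)%N ->
  ((2 ^+ k, j%:R^-1) : Cplx R * Cplx R) \in zeros_seq n.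
Proof.
move=> kn jc; apply/flatten_mapP; exists k; first by rewrite mem_iota.
by apply: map_f; rewrite mem_iota add0n ltnS.
Qed.

Lemma cball_expn2_le (r : R) k w : cball r (2 ^+ k, w) -> 2 ^+ k <= r.
Proof.
by move=> qr; rewrite -(normc_expn2 R k); exact: le_trans (normc1_le_euclid _) qr.
Qed.

Lemma closed_cs_zeros (r : R) : closed (cs_zeros c `&` @cball R r).
Proof.
have [N rN] := exists_expn2_gt r.
have /accessible_finite_set_closed := hausdorff_accessible (@Cplx2_hausdorff R).
apply.
apply: sub_finite_set (finite_seq (zeros_seq N)).
move=> _ [[k [j [k1 /andP[j1 jc] ->]]] /cball_expn2_le kr] /=.
apply: mem_zeros_seq => //.
have := le_lt_trans kr rN; rewrite ltr_eXn2l // ltr1n //.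
Qed.

(** The truncations of [F] are the approximations that
    [component_meets_zeros] asks for, and the zeros in the ball form a closed
    set because there are finitely many. *)
Lemma island_at_zero (r delta : R) (I : set (Cplx R * Cplx R)) :
  0 < r -> 0 < delta -> islands F r delta I ->
  exists2 q, cs_zeros c q & [/\ cball r q, I q &
    I = connected_component (sublevel F r delta) q].
Proof.
move=> r0 d0 [[p Xp ->] Ib].
have Zsub q : (cs_zeros c `&` cball r) q -> cball r q -> sublevel F r delta q.
  by move=> [Zq _] qr; split=> //=; rewrite cs_map_zeros // ltW.
have [|q [Iq [Zq qr]]] := component_meets_zeros r0 (continuous_cs_map1 c_ge)
  (continuous_cs_map2 c_ge) (@closed_cs_zeros r) _ Xp Ib Zsub.
  move=> e e0; have [K KP] := cs_map_approx c_ge (ltW r0).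
  have [n Kn] := exists_geometric_lt K e0.
  pose m := n.+1.
  have Km : K / 2 ^+ m <= e.
    have [K0|K0] := leP 0 K.
      apply: le_trans (ltW Kn); rewrite ler_wpM2l // lef_pV2 ?posrE ?exprn_gt0 //.
      by rewrite ler_eXn2l ?ltr1n.
    apply: le_trans (ltW e0); rewrite nmulr_rle0 // invr_ge0 exprn_ge0 //.
  exists (dyadic_poly R predT m), (cs_f_approx_poly c m); split.
  - rewrite ltnNge; apply/negP => /size1_polyC GE.
    have Gcst (x y : Cplx R) : dyadic_prod predT m x = dyadic_prod predT m y.
      by rewrite -!horner_dyadic_poly GE !hornerC.
    have : dyadic_prod predT m (0 : Cplx R) = 0.
      rewrite (Gcst 0 2); apply/eqP/dyadic_prod_eq0P.
      by exists 1%N; rewrite expr1.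
    move=> /eqP/dyadic_prod_eq0P[k [_ _ /esym/eqP]].
    by rewrite expf_eq0 pnatr_eq0 andbF.
  - under eq_fun do rewrite horner_cs_f_approx_poly.
    exact: continuous_cs_f_approx.
  - move=> q qr; rewrite horner_dyadic_poly horner_cs_f_approx_poly.
    by have [h1 h2] := KP m q qr; split; exact: le_trans Km.
  - move=> q qr; rewrite horner_dyadic_poly horner_cs_f_approx_poly => h1 h2.
    by split=> //; exact: cs_approx_zeros h1 h2.
by exists q => //; split=> //; exact: same_connected_component.
Qed.

(** The segment is followed along real second coordinates, which suffices
    since the zeros [1 / j] are real. *)
Lemma slice_connected (X : set (Cplx R * Cplx R)) z (s : R) :
  (forall t, 0 <= t -> t <= s -> X (z, t%:C%C)) ->
  forall t, 0 <= t -> t <= s -> connected_component X (z, 0) (z, t%:C%C).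
Proof.
move=> Xz t t0 ts.
pose L := (fun x : R^o => (z, x%:C%C) : Cplx R * Cplx R) @` `[0, t].
have cL : connected L.
  apply: connected_continuous_connected; first exact: segment_connected.
  apply: continuous_subspaceT => x A /nbhs_Cplx2P[d d0 dA].
  apply/nbhs_ballP; exists d => //= y xy.
  have yx : normc (y%:C%C - x%:C%C : Cplx R) < d.
    by rewrite -(rmorphB (real_complex R)) normc_real distrC.
  by apply: dA => //; rewrite subrr ComplexField.Normc.normc0.
have LX : L `<=` X.
  move=> _ [x /= + <-]; rewrite in_itv /= => /andP[x0 xt].
  by apply: Xz => //; exact: le_trans xt ts.
apply: (connected_component_max _ LX cL).
- by exists 0 => //=; rewrite in_itv /= lexx.
- by exists t => //=; rewrite in_itv /= lexx t0.
Qed.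

(** A zero over [k] accounts for a given island.  Small [k] contribute to the
    constant; for the others the island is the component of [(2 ^ k, 0)], and
    it would reach the sphere if [k > N]. *)
Theorem cs_islands_bound (delta : R) : 0 < delta ->
  exists m : nat, forall (r : R) (N : nat), 1 <= r ->
    (forall k, (N < k)%N -> 4 * r ^+ 2 <= 2 ^+ c k) ->
    (zeta0 F r delta <= ((N + m)%:R : R)%:E)%E.
Proof.
move=> d0; have [K0 K0P] := exists_expn2_gt (delta ^- 2).
(* From [K] on, the norm of [F] is at most [delta] on the segments used below;
   [K >= 2] gives [4 <= 2 ^ (c k)], which covers [|w| <= 1]. *)
pose K := maxn 2 K0.
have small k : (K <= k)%N -> 2 ^- c k <= delta ^+ 2.
  move=> Kk; have k1 : (1 <= k)%N by apply: leq_trans Kk; rewrite leq_max.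
  rewrite -[leRHS]invrK lef_pV2 ?posrE ?invr_gt0 ?exprn_gt0 //.
  rewrite (le_trans (ltW K0P)) // ler_eXn2l ?ltr1n //.
  by apply: leq_trans (c_ge k1); apply: leq_trans Kk; rewrite leq_maxr.
exists (size (zeros_seq K)).+1 => r N r1 rN.
have r0 : 0 < r := lt_le_trans ltr01 r1.
pose X := sublevel F r delta.
pose s := [seq connected_component X q | q <- zeros_seq K] ++
          [seq connected_component X (2 ^+ k, 0) | k <- iota 0 N.+1].
apply: le_trans (counting_le_size (s := s) _ _) _; last first.
  by rewrite lee_fin ler_nat size_cat !size_map size_iota addnS addnC addnS.
move=> I II /=; have [q [k [j [k1 /andP[j1 jc] qE]]] [qr Iq IE]] :=
  island_at_zero r0 d0 II.
rewrite qE in qr Iq IE.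
have jE : (j%:R^-1 : Cplx R) = (j%:R^-1 : R)%:C%C by rewrite fmorphV rmorph_nat.
have j0 : 0 <= j%:R^-1 :> R by rewrite invr_ge0.
have jle1 : j%:R^-1 <= 1 :> R by rewrite invf_le1 ?ler1n ?ltr0n.
rewrite mem_cat; apply/orP; have [kK|Kk] := ltnP k K.
  by left; rewrite IE; apply: map_f; exact: mem_zeros_seq.
have real_ball (t : R) : 0 <= t -> (cball r (2 ^+ k : Cplx R, t%:C%C : Cplx R)) =
    (((2 ^+ k) ^+ 2 + t ^+ 2 <= r ^+ 2) : Prop).
  move=> t0; rewrite /cball /= le_euclid_norm ?(ltW r0) //.
  by rewrite [(2 ^+ k, _).1]/= normc_expn2 [(2 ^+ k, _).2]/= normc_real ger0_norm.
have qr2 : (2 ^+ k) ^+ 2 + (j%:R^-1) ^+ 2 <= r ^+ 2.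
  by move: qr; rewrite jE real_ball.
have Xslice (t s0 : R) : 0 <= t -> t <= s0 -> (2 ^+ k) ^+ 2 + s0 ^+ 2 <= r ^+ 2 ->
    (1 + s0) ^+ 2 <= 2 ^+ c k -> X (2 ^+ k, t%:C%C).
  move=> t0 ts s0r s0c; split; last first.
    rewrite real_ball //; apply: le_trans s0r; rewrite lerD2l ler_pXn2r ?nnegrE //.
    exact: le_trans t0 ts.
  apply: (cs_map_slice_small c_ge k1 (ltW d0) (small k Kk)).
  apply: le_trans s0c; rewrite normc_real ger0_norm //.
  by rewrite ler_pXn2r ?nnegrE ?lerD2l // addr_ge0 // (le_trans t0).
have [kN|Nk] := leqP k N.
  right; rewrite IE.
  have -> : connected_component X (2 ^+ k, j%:R^-1) = connected_component X (2 ^+ k, 0).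
    apply: esym; apply: same_connected_component; rewrite jE.
    apply: (@slice_connected X (2 ^+ k) j%:R^-1) => // t t0 tj.
    apply: (Xslice t j%:R^-1) => //.
    apply: le_trans (_ : 2 ^+ 2 <= _).
      by rewrite ler_pXn2r ?nnegrE ?addr_ge0 // -[2]/(1 + 1 : R) lerD2l.
    rewrite ler_eXn2l ?ltr1n //; apply: leq_trans (c_ge k1).
    by apply: leq_trans Kk; rewrite leq_maxl.
  by apply: (map_f (fun k => connected_component X (2 ^+ k, 0))); rewrite mem_iota.
exfalso.
(* [(2 ^ k, s0)] is where the slice meets the sphere. *)
pose s0 := Num.sqrt (r ^+ 2 - (2 ^+ k) ^+ 2).
have s02 : s0 ^+ 2 = r ^+ 2 - (2 ^+ k) ^+ 2.
  rewrite sqr_sqrtr // subr_ge0; apply: le_trans qr2.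
  by rewrite lerDl sqr_ge0.
have s00 : 0 <= s0 := sqrtr_ge0 _.
have js0 : j%:R^-1 <= s0.
  by rewrite -(@ler_pXn2r _ 2) ?nnegrE // s02 lerBrDl.
have s0r : s0 <= r.
  rewrite -(@ler_pXn2r _ 2) ?nnegrE ?(ltW r0) // s02 gerBl.
  by rewrite sqr_ge0.
have s0c : (1 + s0) ^+ 2 <= 2 ^+ c k.
  apply: le_trans (rN k Nk); have -> : 4 * r ^+ 2 = (2 * r) ^+ 2 by ring.
  rewrite ler_pXn2r ?nnegrE ?addr_ge0 ?mulr_ge0 ?(ltW r0) //; lra.
have s0b : (2 ^+ k) ^+ 2 + s0 ^+ 2 = r ^+ 2 by rewrite s02 addrC subrK.
have conn (t : R) : 0 <= t -> t <= s0 ->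
    connected_component X (2 ^+ k, 0) (2 ^+ k, t%:C%C).
  apply: (@slice_connected X (2 ^+ k) s0) => // {}t t0 ts.
  by apply: (Xslice t s0) => //; rewrite s0b.
have Ib : I (2 ^+ k, s0%:C%C).
  rewrite IE; rewrite jE; apply: connected_component_trans (conn s0 s00 (lexx _)).
  by apply: connected_component_sym; exact: conn.
have : (I `&` boundary (cball r)) (2 ^+ k, s0%:C%C).
  split=> //; apply: sphere_boundary => //.
  apply/eqP; rewrite -(@eqrXn2 _ 2) ?euclid_norm_ge0 ?(ltW r0) //.
  rewrite sqr_euclid_norm [(2 ^+ k, _).1]/= normc_expn2.
  by rewrite [(2 ^+ k, _).2]/= normc_real ger0_norm // s0b.
by case: II => _ ->.
Qed.

End CountingIslands.

(** * Iterated exponentials *)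

Section IteratedLogarithms.
Variable R : realType.
Implicit Types (x y : R) (n l : nat).

Lemma exp2E x : exp2 x = expR (x * ln 2).
Proof. by rewrite /exp2 /powR pnatr_eq0. Qed.

Lemma ln2_gt0 : 0 < ln 2 :> R.
Proof. by rewrite ln_gt0 // ltr1n. Qed.

Lemma exp2_gt0 x : 0 < exp2 x.
Proof. by rewrite exp2E expR_gt0. Qed.

Lemma ler_exp2 x y : (exp2 x <= exp2 y) = (x <= y).
Proof. by rewrite !exp2E ler_expR ler_pM2r // ln2_gt0. Qed.

Lemma exp2D x y : exp2 (x + y) = exp2 x * exp2 y.
Proof. by rewrite !exp2E mulrDl expRD. Qed.

Lemma exp2_nat n : exp2 n%:R = 2 ^+ n :> R.
Proof. by rewrite /exp2 powR_mulrn. Qed.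

Lemma exp2_ge1 x : 0 <= x -> 1 <= exp2 x.
Proof. by move=> x0; rewrite -[leLHS](expr0 2) -exp2_nat ler_exp2. Qed.

Lemma log2K x : 0 < x -> exp2 (log2 x) = x.
Proof. by move=> x0; rewrite exp2E /log2 divfK ?lnK // gt_eqF // ln2_gt0. Qed.

Lemma iter_exp2_ge1 n : 1 <= iter n (@exp2 R) 1.
Proof. by elim: n => [//|n IH] /=; rewrite exp2_ge1 // (le_trans ler01). Qed.

Lemma ler_iter_exp2 n x y : x <= y -> iter n (@exp2 R) x <= iter n (@exp2 R) y.
Proof. by move=> xy; elim: n => //= n IH; rewrite ler_exp2. Qed.

Lemma log2_ge_iter_exp2 n x :
  iter n.+1 (@exp2 R) 1 <= x -> iter n (@exp2 R) 1 <= log2 x.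
Proof.
move=> nx; rewrite -ler_exp2 log2K //; exact: lt_le_trans (exp2_gt0 _) nx.
Qed.

Lemma iter_log2_ge1 n x : iter n (@exp2 R) 1 <= x -> 1 <= iter n (@log2 R) x.
Proof.
elim: n x => [//|n IH] x nx; rewrite iterSr; apply: IH.
exact: log2_ge_iter_exp2.
Qed.

(** The innermost logarithm turns the factor [4] into a summand [2], and the
    outer ones, applied to numbers at least [1], do not increase it. *)
Lemma iter_exp2_log2_add2 l x : (1 <= l)%N -> iter l (@exp2 R) 1 <= x ->
  4 * x <= iter l (@exp2 R) (iter l (@log2 R) x + 2).
Proof.
have exp2_log2_add2 y : 0 < y -> exp2 (log2 y + 2) = 4 * y.
  by move=> y0; rewrite exp2D log2K // (exp2_nat 2) mulrC -natrX.
elim: l x => [//|[|l] IH] x _ lx.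
  by rewrite [iter _ _ _]/= exp2_log2_add2 // (lt_le_trans _ lx) ?exp2_gt0.
have x0 : 0 < x := lt_le_trans (exp2_gt0 _) lx.
have llx := log2_ge_iter_exp2 lx.
have log1 : 1 <= log2 x := le_trans (iter_exp2_ge1 _) llx.
rewrite [X in X + 2]iterSr iterS -(exp2_log2_add2 x x0) ler_exp2.
apply: le_trans (IH _ isT llx).
by move: (log2 x) log1 => u u1; lra.
Qed.

End IteratedLogarithms.

Section ExponentialSequences.
Variable R : realType.

Lemma strictly_increasing_ge_id (c : nat -> nat) :
  (1 <= c 1)%N -> strictly_increasing_from1 c -> forall i, (1 <= i)%N -> (i <= c i)%N.
Proof.
move=> c1 cS; elim=> [//|[//|i] IH] _.
have ci := IH isT; have cSi := cS i.+1 i.+2 isT (ltnSn _).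
exact: leq_ltn_trans ci cSi.
Qed.

Lemma exp_seq_gt0 l (lambda : R) i : 0 < lambda -> (1 <= l)%N -> (1 <= exp_seq l lambda i)%N.
Proof.
case: l => // l lambda0 _; rewrite /exp_seq truncn_gt0 iterS exp2_ge1 //.
case: l => [|l] /=; first by rewrite mulr_ge0 // ltW.
by rewrite ltW // exp2_gt0.
Qed.

Lemma cs_islands_exp_seq (lambda delta : R) (l : nat) :
  0 < lambda -> 0 < delta -> (1 <= l)%N ->
  strictly_increasing_from1 (exp_seq l lambda) ->
  exists m : R, forall r : R, iter l.+1 (@exp2 R) 1 <= r ->
    (zeta0 (cs_map (exp_seq l lambda)) r delta
       <= (lambda^-1 * iter l.+1 (@log2 R) r + m)%:E)%E.
Proof.
move=> lambda0 delta0 l1 cS.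
have c_ge := strictly_increasing_ge_id (exp_seq_gt0 1 lambda0 l1) cS.
have [m mP] := cs_islands_bound c_ge delta0.
exists (lambda^-1 * 2 + m%:R) => r lr.
have r1 : 1 <= r := le_trans (iter_exp2_ge1 _ _) lr.
have r0 : 0 < r := lt_le_trans ltr01 r1.
set L := iter l.+1 _ r.
have L1 : 1 <= L := iter_log2_ge1 lr.
have lx := log2_ge_iter_exp2 lr.
have x2 : 2 <= log2 r.
  apply: le_trans lx; case: (l) l1 => // l' _.
  rewrite iterS -[leLHS](expr1 2) -exp2_nat ler_exp2; exact: iter_exp2_ge1.
(* For [k > N] one has [lambda * k >= L + 2], hence
   [c k + 1 > 4 * log2 r >= 2 * log2 r + 3] since [log2 r >= 2]. *)
pose N := Num.truncn (lambda^-1 * (L + 2)).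
have arg0 : 0 <= lambda^-1 * (L + 2) by rewrite mulr_ge0 ?invr_ge0 ?ltW //; lra.
have /andP[Nle _] := truncn_itv arg0.
apply: le_trans (mP r N r1 _) _; last first.
  by rewrite lee_fin natrD addrA lerD2r -mulrDr.
move=> k Nk.
have lk : L + 2 <= lambda * k%:R.
  rewrite -ler_pdivrMl //; apply: le_trans (_ : N.+1%:R <= _); last by rewrite ler_nat.
  by apply: ltW; exact: truncnS_gt.
have big : 4 * log2 r <= iter l (@exp2 R) (lambda * k%:R).
  apply: le_trans (iter_exp2_log2_add2 l1 lx) _.
  by apply: ler_iter_exp2; rewrite -iterSr.
have ck : 2 + (log2 r + log2 r) <= (exp_seq l lambda k)%:R.
  have := truncnS_gt (iter l (@exp2 R) (lambda * k%:R)).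
  by rewrite -/(exp_seq l lambda k) -natr1; lra.
have -> : 4 * r ^+ 2 = exp2 (2 + (log2 r + log2 r)).
  by rewrite !exp2D log2K // (exp2_nat _ 1) expr1; ring.
by rewrite -exp2_nat ler_exp2.
Qed.

Lemma exp_seq_doubly_exponential : exp_seq 2 (1 : R) = fun i => (2 ^ (2 ^ i))%N.
Proof.
by apply/funext => i; rewrite /exp_seq /= mul1r exp2_nat -natrX exp2_nat -natrX natrK.
Qed.

Lemma zeta0_ge0 F (r delta : R) : (0 <= zeta0 F r delta)%E.
Proof. by rewrite /zeta0 /counting; case: ifPn => _; rewrite ?lee_fin ?leey. Qed.

End ExponentialSequences.

Theorem theorem1p9 (R : realType) :
  (forall (lambda delta : R) (l : nat),
     0 < lambda -> 0 < delta -> (1 <= l)%N ->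
     strictly_increasing_from1 (exp_seq l lambda) ->
     exists m : R, forall r : R, iter l.+1 (@exp2 R) 1 <= r ->
       (zeta0 (cs_map (exp_seq l lambda)) r delta
          <= (lambda^-1 * iter l.+1 (@log2 R) r + m)%:E)%E)
  /\
  (forall delta : R, 0 < delta ->
     (\forall r \near +oo,
        zeta0 (cs_map (fun i => (2 ^ (2 ^ i))%N)) r delta \is a fin_num) /\
     (fun r : R => fine (zeta0 (cs_map (fun i => (2 ^ (2 ^ i))%N)) r delta) : R^o)
       =O_ (at_pinfty R) (fun r : R => log2 (log2 (log2 r)) : R^o)).
Proof.
split; first exact: cs_islands_exp_seq.
move=> delta delta0.
have cS : strictly_increasing_from1 (exp_seq 2 (1 : R)).
  by move=> i j _ ij; rewrite exp_seq_doubly_exponential !ltn_exp2l.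
have [m mP] := @cs_islands_exp_seq R 1 delta 2 ltr01 delta0 isT cS.
rewrite exp_seq_doubly_exponential in mP.
pose r0 := iter 3 (@exp2 R) 1.
have fin r : r0 <= r -> zeta0 (cs_map (fun i => (2 ^ (2 ^ i))%N)) r delta \is a fin_num.
  move=> r0r; rewrite ge0_fin_numE ?zeta0_ge0 //.
  by apply: le_lt_trans (mP r r0r) _; rewrite ltry.
split.
  exists r0; split; first exact: num_real.
  by move=> r /ltW; exact: fin.
apply/eqOP; exists (1 + `|m|); split; first exact: num_real.
move=> K mK; exists r0; split; first exact: num_real.
move=> r /ltW r0r /=.
have L1 := iter_log2_ge1 r0r.
have := mP r r0r; rewrite -(fineK (fin r r0r)) lee_fin invr1 mul1r /= => zle.
rewrite ger0_norm; last by rewrite fine_ge0 // zeta0_ge0.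
rewrite ger0_norm; last by rewrite (le_trans ler01).
apply: le_trans zle _.
apply: le_trans (_ : (1 + `|m|) * log2 (log2 (log2 r)) <= _); last first.
  by apply: ler_wpM2r; [exact: le_trans ler01 L1|exact: ltW].
rewrite mulrDl mul1r lerD2l (le_trans (ler_norm m)) //.
by rewrite ler_peMr.
Qed.
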